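(* For $n\ge 0$ let $c_n$ be the number of real roots of the Bernoulli polynomial $B_n(x)$, counted with multiplicity. Then, as $n\to\infty$, $$c_n=\frac{2n}{\pi e}+\frac{\ln n}{\pi e}+O(1).$$
   Context: The Bernoulli polynomials $B_n(x)\in\mathbb{Q}[x]$ are defined by the identity $\frac{te^{tx}}{e^t-1}=\sum_{n=0}^\infty \frac{B_n(x)}{n!}t^n$ in $\mathbb{Q}[x][[t]]$. *)

(* Defs.v *)
From HB Require Import structures.
From mathcomp Require Import all_boot all_order all_algebra.
From mathcomp Require Import polyrcf.
From mathcomp Require Import all_classical all_reals all_analysis.
Set Implicit Arguments.
Unset Strict Implicit.
Unset Printing Implicit Defensive.
Import Order.TTheory GRing.Theory Num.Theory.
Local Open Scope ring_scope.

(* An element of Q[x][[t]], given by its coefficients in t. *)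
Definition fps := nat -> {poly rat}.

Definition fps_sub (f g : fps) : fps := fun n => f n - g n.

Definition fps_mul (f g : fps) : fps := fun n => \sum_(i < n.+1) f i * g (n - i)%N.

Definition fps_one : fps := fun n => (n == 0%N)%:R.

Definition fps_t : fps := fun n => (n == 1%N)%:R.

(* e^t *)
Definition fps_exp : fps := fun n => ((n`!)%:R^-1)%:P.

(* e^(tx), x being the polynomial variable 'X *)
Definition fps_exp_x : fps := fun n => (n`!)%:R^-1 *: 'X^n.

(* sum_n B_n(x) / n! t^n *)
Definition fps_egf (B : nat -> {poly rat}) : fps := fun n => (n`!)%:R^-1 *: B n.

(* The generating identity t e^(tx) / (e^t - 1) = sum_n B_n(x) / n! t^n.
   Since e^t - 1 has zero constant term it is not a unit of Q[x][[t]]; the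
   quotient is taken in the sense of exact division in this integral domain,
   i.e. (e^t - 1) * sum_n B_n(x) / n! t^n = t e^(tx). Existence and uniqueness
   of such a B are bernoulli_exists and bernoulli_unique below. *)
Definition is_bernoulli (B : nat -> {poly rat}) : Prop :=
  fps_mul (fps_sub fps_exp fps_one) (fps_egf B) =1 fps_mul fps_t fps_exp_x.

(* rootsR p lists the distinct roots of p in R, without repetition. *)
Definition count_real_roots (R : realType) (p : {poly rat}) : nat :=
  let pR : {poly R} := map_poly ratr p in \sum_(x <- rootsR pR) mup x pR.

Local Notation em1 := (fps_sub fps_exp fps_one).

Fact em1_0 : em1 0%N = 0.
Proof. by rewrite /fps_sub /fps_exp /fps_one fact0 invr1 subrr. Qed.

Fact em1_1 : em1 1%N = 1.
Proof. by rewrite /fps_sub /fps_exp /fps_one invr1 subr0. Qed.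

Fact em1_mulS (f : fps) n :
  fps_mul em1 f n.+1 = f n + \sum_(i < n) em1 i.+2 * f (n - i.+1)%N.
Proof.
rewrite /fps_mul big_ord_recl em1_0 mul0r add0r big_ord_recl em1_1 mul1r.
by rewrite subn1 /=; congr (_ + _); apply: eq_bigr => i _; rewrite subSS.
Qed.

Fact egf_fact (B : nat -> {poly rat}) n : B n = (n`!)%:R *: fps_egf B n.
Proof.
by rewrite /fps_egf scalerA divff ?scale1r.
Qed.

Lemma bernoulli_unique (B B' : nat -> {poly rat}) :
  is_bernoulli B -> is_bernoulli B' -> B =1 B'.
Proof.
move=> hB hB' n; rewrite (egf_fact B) (egf_fact B'); congr (_ *: _).
have [m] := ubnP n; elim: m n => // m IH n /ltnSE le_nm.
have := hB n.+1; rewrite -(hB' n.+1) !em1_mulS.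
have -> : \sum_(i < n) em1 i.+2 * fps_egf B (n - i.+1)%N
        = \sum_(i < n) em1 i.+2 * fps_egf B' (n - i.+1)%N.
  apply: eq_bigr => i _; rewrite IH //; apply: leq_trans le_nm.
  by rewrite ltn_subrL /= (leq_trans _ (ltn_ord i)).
exact: addIr.
Qed.

Lemma bernoulli_exists : exists B, is_bernoulli B.
Proof.
pose rhs := fps_mul fps_t fps_exp_x.
pose next (s : seq {poly rat}) :=
  rhs (size s).+1 - \sum_(i < size s) em1 i.+2 * s`_(size s - i.+1).
pose pre n := iter n (fun s => rcons s (next s)) [::].
have size_pre n : size (pre n) = n by elim: n => //= n IH; rewrite size_rcons IH.
pose f n := next (pre n).
have nth_pre n k : (k < n)%N -> (pre n)`_k = f k.
  elim: n => // n IH; rewrite ltnS leq_eqVlt /= nth_rcons size_pre.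
  by case/orP => [/eqP -> | lt_kn]; [rewrite ltnn eqxx | rewrite lt_kn IH].
exists (fun n => (n`!)%:R *: f n).
have egfE : fps_egf (fun n => (n`!)%:R *: f n) = f.
  apply/funext => n; rewrite /fps_egf scalerA mulVf ?scale1r //.
rewrite /is_bernoulli egfE => -[|n].
  by rewrite /fps_mul !big_ord1 em1_0 /fps_t !mul0r.
rewrite em1_mulS {1}/f /next size_pre -/rhs -addrA [X in _ + X]addrC.
rewrite (eq_bigr (fun i : 'I_n => em1 i.+2 * (pre n)`_(n - i.+1))) ?subrr ?addr0 //.
move=> i _; rewrite nth_pre // ltn_subrL /=.
by rewrite (leq_trans _ (ltn_ord i)).
Qed.

(* Main.v *)
(* Idea. With [b_n = (2 pi)^n B_n / n!] and [z = 2 pi (x - 1/2)], the identity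
   [sinh (t/2) / (t/2) * sum_n B_n(x) t^n / n! = e^(t(x-1/2))] is a convolution
   equation for [(b_n(x))_n]. Dividing it by [1 + (t / 2 pi)^2] leaves a kernel
   whose higher coefficients have absolute sum < 1, so [b_n(x)] is exponentially
   close to [2 cos (z - n pi/2) = - 2 cos (2 pi x - n pi/2)], uniformly on [0, 1].
   By [B_n(x+1) - B_n(x) = n x^(n-1)], this persists until [(2 pi x)^n / n!]
   becomes of order 1, which by Stirling's formula happens within O(1) of
   [W_n = n / (2 pi e) + ln n / (4 pi e)]; up to there each half-period contains
   exactly one simple root. Beyond, [B_(n-J)] is positive for a constant [J], so
   [J] applications of Rolle's theorem leave at most [J] roots. With the symmetry
   [x -> 1 - x] the number of roots is [4 W_n + O(1)]. *)
Require Import Defs.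
From HB Require Import structures.
From mathcomp Require Import all_boot all_order all_algebra.
From mathcomp Require Import polyrcf.
From mathcomp Require Import all_classical all_reals all_analysis.
From mathcomp Require Import ring lra zify.
Set Implicit Arguments.
Unset Strict Implicit.
Unset Printing Implicit Defensive.
Import Order.TTheory GRing.Theory Num.Theory.
Import numFieldNormedType.Exports.
Local Open Scope ring_scope.
Local Open Scope classical_set_scope.

(** * Algebra of Bernoulli polynomials *)

(** After the scaling, the kernel sinh (t/2) / (t/2) has a coefficient pi^2/6 > 1, so an induction
    on the convolution equation as it stands does not contract. The cause is the pair of zeros at t
    = 2 pi i and t = - 2 pi i, which also produces the cosine. Dividing them out leaves coefficients
    that are tails of the sine series at pi, small because sin pi = 0; the value of the quotient at
    the removed zeros is 1/2, whence the amplitude 2. Only real power series and rational bounds on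
    pi enter. Simplicity of the roots comes from the next lower index: the derivative of B_(n+1) is
    a multiple of B_n, whose cosine is a quarter period out of phase, so the two cannot be small
    together. Hence the bulk is controlled for two consecutive indices at once. The oscillating zone
    and the zone without roots leave a gap of bounded width around the front. Lowering the index by
    J moves the front left by at least J/26, so a constant J closes the gap. *)

Section BernoulliAlgebra.
Variable R : numFieldType.
Implicit Types (b c : nat -> {poly R}) (n : nat) (x : R).

(** Here [b n] stands for B_n(x) / n!, and the equation is the coefficient of t^n in (e^t - 1) / t *
    sum_n b_n t^n = e^(tx). This normalisation makes [b] an Appell sequence without factors; the
    powers of 2 pi enter only in [scaled_val]. *)
Definition bernoulli_egf b := forall n,
  \sum_(i < n.+1) (i.+1`!)%:R^-1 *: b (n - i)%N = (n`!)%:R^-1 *: 'X^n.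

Lemma factr_neq0 n : n`!%:R != 0 :> R.
Proof. by rewrite pnatr_eq0 -lt0n fact_gt0. Qed.

Lemma factrS n : n.+1`!%:R = n.+1%:R * n`!%:R :> R.
Proof. by rewrite factS natrM. Qed.

Lemma bernoulli_egf_uniq b c : bernoulli_egf b -> bernoulli_egf c -> b =1 c.
Proof.
move=> hb hc n; have [m] := ubnP n; elim: m n => // m IH n /ltnSE le_nm.
have := hb n; rewrite -(hc n) !big_ord_recl /= !subn0 invr1 !scale1r.
rewrite (eq_bigr (fun i : 'I_n => (i.+2`!)%:R^-1 *: c (n - i.+1)%N)); last first.
  by move=> i _; rewrite /bump /= add1n IH //; have := ltn_ord i; lia.
exact: addIr.
Qed.

Lemma bernoulli_egf0 b : bernoulli_egf b -> b 0%N = 1.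
Proof. by move/(_ 0%N); rewrite big_ord1 /= invr1 !scale1r expr0. Qed.

(** Differentiating the equation of index n+1 shows that the shifted derivatives solve the same
    triangular system, whose solution is unique. *)
Lemma bernoulli_egf_deriv b : bernoulli_egf b -> forall n, deriv (b n.+1) = b n.
Proof.
move=> hb n; move: n; apply: bernoulli_egf_uniq (hb) => n.
have := congr1 (@deriv R) (hb n.+1).
rewrite derivZ derivXn big_ord_recr /= subnn (bernoulli_egf0 hb) derivD.
rewrite [deriv (_ *: 1)]derivZ derivC scaler0 addr0 raddf_sum /= => h.
transitivity ((n.+1)`!%:R^-1 *: ('X^n *+ n.+1) : {poly R}); last first.
  by rewrite -['X^n *+ _]scaler_nat scalerA factrS invfM mulrAC mulVf ?mul1r ?pnatr_eq0.
rewrite -h; apply: eq_bigr => i _; rewrite derivZ subSn //.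
by rewrite -ltnS.
Qed.

Lemma appell_derivn b : b 0%N = 1 -> (forall n, deriv (b n.+1) = b n) ->
  forall k n, derivn k (b n) = if (k <= n)%N then b (n - k)%N else 0.
Proof.
move=> b0 hd; elim=> [|k IH] n; first by rewrite derivn0 subn0.
rewrite derivSn; case: n => [|n]; last by rewrite hd IH ltnS subSS.
by rewrite b0 derivC linear0.
Qed.

Lemma appell_size b : b 0%N = 1 -> (forall n, deriv (b n.+1) = b n) ->
  forall n, (size (b n) <= n.+1)%N.
Proof.
move=> b0 hd n; have := appell_derivn b0 hd n.+1 n; rewrite ltnn => h.
apply/leq_sizeP => j lt_nj; have := coef_derivn n.+1 (b n) (j - n.+1).
rewrite h coef0 subnKC // => /esym/eqP; rewrite mulrn_eq0.
by rewrite eqn0Ngt ffact_gt0 lt_nj /= => /eqP.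
Qed.

Lemma appell_taylor b : b 0%N = 1 -> (forall n, deriv (b n.+1) = b n) ->
  forall n x h, (b n).[x + h] = \sum_(i < n.+1) (b (n - i)%N).[x] * h ^+ i / i`!%:R.
Proof.
move=> b0 hd n x h.
rewrite (@nderiv_taylor_wide _ n.+1) ?(appell_size b0 hd) //; last exact: mulrC.
apply: eq_bigr => -[i /= lt_in] _; rewrite mulrAC; congr (_ * _).
apply: (mulIf (factr_neq0 i)); rewrite mulfVK ?factr_neq0 //.
rewrite mulr_natr -hornerMn -nderivn_def (appell_derivn b0 hd).
by rewrite -ltnS lt_in.
Qed.

(** The Taylor expansion with step 1, deprived of its constant term, is the defining convolution
    evaluated at x. *)
Lemma bernoulli_egf_diff b : bernoulli_egf b -> forall n x,
  (b n.+1).[x + 1] - (b n.+1).[x] = x ^+ n / n`!%:R.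
Proof.
move=> hb n x.
rewrite (appell_taylor (bernoulli_egf0 hb) (bernoulli_egf_deriv hb)).
rewrite big_ord_recl /= subn0 expr0 mulr1 divr1 addrC addKr.
have := congr1 (horner^~ x) (hb n).
rewrite hornerZ hornerXn horner_sum [in RHS]mulrC => <-.
apply: eq_bigr => i _; rewrite hornerZ /bump /= add1n subSS expr1n mulr1.
by rewrite mulrC.
Qed.

Lemma polyP_eval (p q : {poly R}) : (forall x, p.[x] = q.[x]) -> p = q.
Proof.
move=> h; apply/eqP; rewrite -subr_eq0; apply/eqP.
apply: (@roots_geq_poly_eq0 _ _ [seq i%:R | i <- iota 0 (size (p - q))]).
- by apply/allP => y _; rewrite rootE hornerD hornerN h subrr.
- by rewrite map_inj_uniq ?iota_uniq // => i j /eqP; rewrite eqr_nat => /eqP.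
- by rewrite size_map size_iota.
Qed.

(** Converse of [bernoulli_egf_diff]: a characterisation through derivative and difference, easier
    to verify for a transformed sequence than the convolution. *)
Lemma appell_diff_egf b : b 0%N = 1 -> (forall n, deriv (b n.+1) = b n) ->
  (forall n x, (b n.+1).[x + 1] - (b n.+1).[x] = x ^+ n / n`!%:R) ->
  bernoulli_egf b.
Proof.
move=> b0 hd hdiff n; apply: polyP_eval => x.
rewrite hornerZ hornerXn [RHS]mulrC -hdiff (appell_taylor b0 hd).
rewrite [in RHS]big_ord_recl /= subn0 expr0 mulr1 divr1 addrC addKr.
rewrite horner_sum.
apply: eq_bigr => i _; rewrite hornerZ /bump /= add1n subSS expr1n mulr1.
by rewrite mulrC.
Qed.

(** The sequence (-1)^n b_n(1 - x) is again Appell and satisfies the same difference equation, so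
    uniqueness identifies it with [b]. *)
Lemma bernoulli_egf_reflect b : bernoulli_egf b -> forall n x,
  (b n).[1 - x] = (-1) ^+ n * (b n).[x].
Proof.
move=> hb n x; pose c m : {poly R} := (-1) ^+ m *: (b m \Po (1 - 'X)).
have cE m y : (c m).[y] = (-1) ^+ m * (b m).[1 - y].
  by rewrite /c hornerZ horner_comp !hornerE.
suff hc : bernoulli_egf c.
  have /(congr1 (horner^~ x)) /= := bernoulli_egf_uniq hb hc n; rewrite cE => ->.
  by rewrite mulrA -exprMn mulrNN mulr1 expr1n mul1r.
apply: appell_diff_egf => [|m|m y].
- by rewrite /c expr0 scale1r (bernoulli_egf0 hb) comp_polyC.
- rewrite /c derivZ deriv_comp (bernoulli_egf_deriv hb) derivB derivC derivX.
  by rewrite sub0r mulrN1 scalerN exprS mulN1r scaleNr opprK.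
- rewrite !cE -mulrBr; have -> : 1 - (y + 1) = - y by ring.
  have := bernoulli_egf_diff hb m (- y); rewrite [- y + 1]addrC => /eqP.
  rewrite subr_eq => /eqP ->; rewrite opprD addrCA subrr addr0.
  rewrite exprS [(- y) ^+ m]exprNn mulN1r mulNr mulrN opprK mulrA mulrA.
  by rewrite -exprMn mulrNN mulr1 expr1n mul1r.
Qed.

Lemma sum_odd_half (F : nat -> R) n :
  (forall i, ~~ odd i -> F i = 0) ->
  \sum_(i < n.+2) F i = \sum_(k < n./2.+1) F k.*2.+1.
Proof.
move=> F0; rewrite -!(big_mkord xpredT F) -(big_mkord xpredT (fun k => F k.*2.+1)).
have [m] := ubnP n; elim: m n => // m IH [|[|n]] le_nm.
- by rewrite !big_nat_recr ?big_geq //= (F0 0%N) // !add0r.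
- by rewrite !big_nat_recr ?big_geq //= (F0 0%N) // (F0 2%N) // !add0r addr0.
rewrite 2?big_nat_recr //= IH; last by lia.
rewrite [in RHS]big_nat_recr //= -addrA; congr (_ + _).
have := odd_double_half n; case: (boolP (odd n)) => on <- /=.
  by rewrite add1n /= uphalf_double doubleS [F _.+4]F0 ?addr0 //= odd_double.
by rewrite add0n /= doubleK doubleS [F _.+2]F0 ?add0r //= odd_double.
Qed.

(* Taylor expansion of B_{n+1}(x + 1/2) - B_{n+1}(x - 1/2): only odd orders remain. *)
Lemma bernoulli_egf_centered b : bernoulli_egf b -> forall n x,
  \sum_(k < n./2.+1) (b (n - k.*2)%N).[x] / (4 ^+ k * k.*2.+1`!%:R)
    = (x - 2^-1) ^+ n / n`!%:R.
Proof.
move=> hb n x; rewrite -(bernoulli_egf_diff hb).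
have -> : x - 2^-1 + 1 = x + 2^-1 by field.
rewrite !(appell_taylor (bernoulli_egf0 hb) (bernoulli_egf_deriv hb)).
rewrite -sumrB.
pose F i := (b (n.+1 - i)%N).[x] * (2^-1 ^+ i - (- 2^-1) ^+ i) / i`!%:R.
rewrite [RHS](eq_bigr (fun i : 'I_n.+2 => F i)); last first.
  by move=> i _; rewrite /F mulrBr mulrBl.
rewrite (sum_odd_half (F := F)) => [|i ei]; last first.
  by rewrite /F exprNn -signr_odd (negbTE ei) expr0 mul1r subrr mulr0 mul0r.
apply: eq_bigr => k _; rewrite /F subSS exprNn -signr_odd /= odd_double /= expr1.
rewrite mulN1r opprK invfM mulrA; congr (_ / _); congr (_ * _).
rewrite exprS -mul2n exprM -mulrDl.
have -> : 2^-1 + 2^-1 = 1 :> R by field.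
have -> : 2^-1 ^+ 2 = 4^-1 :> R by field.
by rewrite mul1r !exprVn.
Qed.

End BernoulliAlgebra.

Lemma is_bernoulli_egf (R : numFieldType) (B : nat -> {poly rat}) :
  is_bernoulli B ->
  bernoulli_egf (fun n => (n`!)%:R^-1 *: map_poly ratr (B n) : {poly R}).
Proof.
move=> hB n; have := hB n.+1.
have -> : fps_mul fps_t fps_exp_x n.+1 = (n`!)%:R^-1 *: 'X^n.
  rewrite /fps_mul big_ord_recl mul0r add0r big_ord_recl mul1r big1 ?addr0.
    by rewrite /fps_exp_x /bump /= subn1.
  by move=> i _; rewrite mul0r.
rewrite /fps_mul big_ord_recl [fps_sub _ _ _]em1_0 mul0r add0r.
move=> /(congr1 (map_poly (@ratr R))).
rewrite raddf_sum /= map_polyZ map_polyXn /= fmorphV /= rmorph_nat => <-.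
apply: eq_bigr => i _; rewrite /fps_sub /fps_egf /fps_one /fps_exp /= subr0 subSS.
by rewrite rmorphM /= map_polyC map_polyZ /= mul_polyC !fmorphV /= !rmorph_nat.
Qed.

(** * Counting real roots *)

Section RootCount.
Variable R : rcfType.
Implicit Types (p q : {poly R}) (P Q : pred R) (x y : R) (s : seq R).

Definition nroots p P : nat := (\sum_(x <- rootsR p | P x) mup x p)%N.

(** A predicate instead of an interval: Rolle's theorem is needed on half-lines and also on the part
    of a cell where a cosine is small. *)
Definition convex_pred P :=
  forall x y z, P x -> P z -> x <= y <= z -> P y.

Lemma mem_rootsR p x : p != 0 -> (x \in rootsR p) = root p x.
Proof. by move=> p0; rewrite -(roots_on_rootsR p0) in_itv. Qed.

Lemma rootsR_sorted p : sorted <%R (rootsR p).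
Proof. exact: sorted_roots. Qed.

Lemma rootsR_uniq p : uniq (rootsR p).
Proof. exact: lt_sorted_uniq (rootsR_sorted p). Qed.

Lemma mup_le_deriv p x : deriv p != 0 -> (mup x p <= (mup x (deriv p)).+1)%N.
Proof.
move=> p'0; have p0 : p != 0 by apply: contraNneq p'0 => ->; rewrite linear0.
case m_eq: (mup x p) => [//|m]; rewrite ltnS mup_geq //.
have : ('X - x%:P) ^+ m.+1 %| p by rewrite -mup_geq // m_eq.
move=> /dvdpP [q ->]; rewrite derivM deriv_exp derivXsubC mul1r /=.
apply: dvdp_add; first by rewrite dvdp_mull // dvdp_exp2l.
by rewrite mulrnAr -mulrnAl dvdp_mull.
Qed.

(* Rolle along an increasing list of roots: a multiple root loses one, and a new
   root appears between any two consecutive ones. *)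
Lemma rolle_seq p P x s : deriv p != 0 -> convex_pred P ->
  path <%R x s -> all (fun y => P y && root p y) (x :: s) ->
  exists t, [/\ path <%R x t, all P (x :: t) &
    (\sum_(y <- x :: s) mup y p <= (\sum_(y <- x :: t) mup y (deriv p)).+1)%N].
Proof.
move=> p'0 cP; elim: s x => [|y s IH] x.
  move=> _ /= /andP[/andP[Px _] _]; exists [::]; split=> //=; first by rewrite Px.
  by rewrite !big_seq1 mup_le_deriv.
move=> /= /andP[lt_xy y_s] /andP[/andP[Px px0] /[dup] ys0 /andP[/andP[Py py0] _]].
have [t [yt Pyt le_t]] := IH y y_s ys0.
have [|r r_xy p'r0] := @poly_rolle _ x y p lt_xy.
  by rewrite (rootP px0) (rootP py0).
move: r_xy; rewrite in_itv /= => /andP[lt_xr lt_ry].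
exists (r :: y :: t); split => /=.
- by rewrite lt_xr lt_ry yt.
- move: Pyt => /= ->; rewrite Px andbT /=.
  by apply: cP Px Py _; rewrite !ltW.
- rewrite big_cons (leq_trans (leq_add (mup_le_deriv x p'0) le_t)) //.
  rewrite [in leqRHS]big_cons [in leqRHS]big_cons addSn addnS ltnS.
  rewrite -addSn -addn1 -addnA leq_add2l leq_add2r.
  by rewrite -XsubC_dvd // dvdp_XsubCl; apply/rootP.
Qed.

Lemma sum_mup_le_nroots p P s : p != 0 -> uniq s -> all P s ->
  (\sum_(y <- s) mup y p <= nroots p P)%N.
Proof.
move=> p0 us /allP Ps.
have -> : (\sum_(y <- s) mup y p = \sum_(y <- s | root p y) mup y p)%N.
  rewrite [LHS](bigID (root p)) /= [X in (_ + X)%N]big1 ?addn0 // => y.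
  exact: mupNroot.
rewrite /nroots -[in leqLHS]big_filter -[in leqRHS]big_filter.
apply: uniq_sub_le_big => /=.
- exact: leqnn.
- by move=> ? ?; exact: leq_addr.
- exact: filter_uniq.
- exact: filter_uniq (rootsR_uniq p).
- by move=> y; rewrite !mem_filter mem_rootsR // => /andP[-> /Ps ->].
Qed.

Lemma nroots_rolle p P : deriv p != 0 -> convex_pred P ->
  (nroots p P <= (nroots (deriv p) P).+1)%N.
Proof.
move=> p'0 cP; have p0 : p != 0 by apply: contraNneq p'0 => ->; rewrite linear0.
rewrite {1}/nroots -big_filter.
have : all (fun y => P y && root p y) [seq y <- rootsR p | P y].
  by apply/allP => y; rewrite mem_filter mem_rootsR.
have : sorted <%R [seq y <- rootsR p | P y].
  by apply: sorted_filter (rootsR_sorted p); exact: lt_trans.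
case: [seq y <- rootsR p | P y] => [|x s] /=; first by rewrite big_nil.
move=> xs rs; have [t [xt Pt]] := rolle_seq p'0 cP xs rs.
move=> /leq_trans; apply; rewrite ltnS.
apply: sum_mup_le_nroots => //.
by apply: lt_sorted_uniq; rewrite /= xt.
Qed.

Lemma nroots_eq0 p P : (forall x, P x -> ~~ root p x) -> nroots p P = 0%N.
Proof. by move=> h; rewrite /nroots big1 // => x /h /mupNroot. Qed.

(** Each Rolle step loses at most one root. Used with j = 1 in a cell of the bulk and with j = J on
    the two tails. *)
Lemma nroots_derivn p P j : derivn j p != 0 -> convex_pred P ->
  (forall x, P x -> ~~ root (derivn j p) x) -> (nroots p P <= j)%N.
Proof.
elim: j p => [|j IH] p; first by move=> _ _ /nroots_eq0 ->.
rewrite derivSn => pj0 cP h; apply: leq_trans (nroots_rolle _ cP) _.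
  by apply: contraNneq pj0 => ->; rewrite linear0.
by rewrite ltnS IH.
Qed.

Lemma nroots_sub p P Q : (forall x, root p x -> P x -> Q x) ->
  (nroots p P <= nroots p Q)%N.
Proof.
move=> PQ; rewrite /nroots [leqLHS]big_mkcond [leqRHS]big_mkcond /=.
apply: leq_sum => x _; case: ifP => // Px; case: ifP => // Qx.
by rewrite mupNroot //; apply: contraFN Qx => /PQ ->.
Qed.

Lemma nrootsU p P Q : (nroots p (predU P Q) <= nroots p P + nroots p Q)%N.
Proof.
rewrite /nroots [leqLHS]big_mkcond [X in (_ <= X + _)%N]big_mkcond.
rewrite [X in (_ <= _ + X)%N]big_mkcond -big_split /=.
by apply: leq_sum => x _; case: (P x); case: (Q x); rewrite ?addn0 ?leq_addr.
Qed.

Lemma nroots_disjoint p P Q : (forall x, P x -> Q x -> false) ->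
  (nroots p P + nroots p Q = nroots p (predU P Q))%N.
Proof.
move=> dPQ; rewrite /nroots [RHS]big_mkcond [X in (X + _)%N]big_mkcond.
rewrite [X in (_ + X)%N]big_mkcond -big_split /=.
apply: eq_bigr => x _; case Px: (P x); case Qx: (Q x) => //=; rewrite ?addn0 //.
by have := dPQ _ Px Qx.
Qed.

(** The cells are closed, so a root at a grid point may be counted twice, which is harmless for an
    upper bound. *)
Lemma nroots_grid_le p (v : nat -> R) c m :
  (forall i, (i < m)%N -> nroots p (fun x => (v i <= x <= v i.+1)%R) <= c)%N ->
  (0 < m)%N ->
  (nroots p (fun x => (v 0%N <= x <= v m)%R) <= m * c)%N.
Proof.
move=> + m0; case: m m0 => // m _; elim: m => [|m IH] h.
  by rewrite mul1n h.
rewrite mulSn addnC; apply: leq_trans (leq_add (IH _) (h m.+1 _)) => //; last first.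
  by move=> i lt_im; apply/h/ltnW.
apply: leq_trans (nrootsU p _ _); apply: nroots_sub => x _ /andP[v0x xvm] /=.
by rewrite v0x xvm andbT /=; exact: le_total.
Qed.

(** Each sign change gives a root in an open cell, and open cells are disjoint, so the counts add
    up. *)
Lemma nroots_grid_ge p (v : nat -> R) m : p != 0 ->
  (forall i, (i < m)%N -> v i < v i.+1) ->
  (forall i, (i < m)%N -> p.[v i] * p.[v i.+1] < 0) ->
  (m <= nroots p (fun x => (v 0%N < x < v m)%R))%N.
Proof.
move=> p0; elim: m => // m IH vS vp.
have vle : v 0%N <= v m.
  elim: m vS {vp IH} => // k IH vS.
  by rewrite (le_trans (IH _)) ?ltW ?vS // => i /ltnW; exact: vS.
have [r] := poly_ivtoo (ltW (vS m (ltnSn m))) (vp m (ltnSn m)).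
rewrite in_itv /= => /andP[vr rv] rp.
have le1 : (0 < nroots p (fun x => (v m < x < v m.+1)%R))%N.
  have : (\sum_(y <- [:: r]) mup y p <= nroots p (fun x => v m < x < v m.+1)%R)%N.
    by apply: sum_mup_le_nroots => //=; rewrite vr rv.
  by apply: leq_trans; rewrite big_seq1 -XsubC_dvd // dvdp_XsubCl.
rewrite -addn1; apply: leq_trans (leq_add (IH _ _) le1) _ => //.
- by move=> i /ltnW; exact: vS.
- by move=> i /ltnW; exact: vp.
rewrite nroots_disjoint => [|x /andP[_ xv] /andP[vx _]]; last first.
  by have := lt_trans xv vx; rewrite ltxx.
apply: nroots_sub => x _ /orP[] /andP[a b].
  by rewrite addn1 /= a (lt_trans b) // vS.
by rewrite addn1 /= b (le_lt_trans vle a).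
Qed.

End RootCount.

(** * Numerical bounds on the trigonometric series *)

Section TrigTails.
Variable R : realType.
Implicit Types (x y z r C l : R) (m n k i : nat).

Lemma expR_ge_term x n : 0 <= x -> x ^+ n / n`!%:R <= expR x.
Proof.
move=> x0; case: n => [|n]; last first.
  by apply: le_trans (expR_ge1Dxn n x0); rewrite lerDr.
by rewrite expr0 fact0 divr1; apply: le_trans (expR_ge1Dx x); rewrite lerDl.
Qed.

Lemma series_tail_le (g : R^nat) l C r m :
  series g @ \oo --> l -> 0 <= r < 1 ->
  (forall i, `|g (m + i)%N| <= C * r ^+ i) -> `|series g m - l| <= C / (1 - r).
Proof.
move=> gl /andP[r0 r1] hg.
have r1' : 0 < 1 - r by lra.
have C0 : 0 <= C by have := hg 0%N; rewrite expr0 mulr1; exact: le_trans.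
(* The factor [1 - r ^+ k] makes the geometric bound provable by induction on k. *)
have part k : `|series g m - series g (m + k)%N| <= C * (1 - r ^+ k) / (1 - r).
  elim: k => [|k IH]; first by rewrite addn0 !subrr normr0 mulr0 mul0r.
  rewrite addnS /series /= big_nat_recr ?leq_addr //= opprD addrA.
  apply: le_trans (ler_normB _ _) _; apply: le_trans (lerD IH (hg k)) _.
  rewrite -[in X in _ + X](mulfK (lt0r_neq0 r1') (C * r ^+ k)) -mulrDl.
  by rewrite ler_pM2r ?invr_gt0 // exprS le_eqVlt; apply/orP; left; apply/eqP; ring.
have lim_g : `|series g m - series g n| @[n --> \oo] --> `|series g m - l|.
  by apply: cvg_norm; exact: (cvgB (cvg_cst _) gl).
apply: (cvgr_to_le lim_g).
near=> n; have /subnKC <- : (m <= n)%N by near: n; exact: nbhs_infty_ge.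
apply: le_trans (part _) _; rewrite ler_pM2r ?invr_gt0 // ler_piMr //.
by rewrite lerBlDr lerDl exprn_ge0.
Unshelve. all: by end_near. Qed.

Lemma cos_tail_le x m C r : 0 <= r < 1 ->
  (forall i, `|x| ^+ (m + i).*2 / (m + i).*2`!%:R <= C * r ^+ i) ->
  `|series (cos_coeff' x) m - cos x| <= C / (1 - r).
Proof.
move=> r01 h; apply: series_tail_le r01 _; first exact: cvg_cos_coeff'.
move=> i; apply: le_trans (h i); rewrite /cos_coeff' !normrM normrX normrN1 expr1n.
by rewrite mul1r normrX normfV normr_nat.
Qed.

Lemma sin_tail_le x m C r : 0 <= r < 1 ->
  (forall i, `|x| ^+ (m + i).*2.+1 / (m + i).*2.+1`!%:R <= C * r ^+ i) ->
  `|series (sin_coeff' x) m - sin x| <= C / (1 - r).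
Proof.
move=> r01 h; apply: series_tail_le r01 _; first exact: cvg_sin_coeff'.
move=> i; apply: le_trans (h i); rewrite /sin_coeff' !normrM normrX normrN1 expr1n.
by rewrite mul1r normrX normfV normr_nat.
Qed.

(** Successive terms of equal parity have ratio x^2 / ((N+1)(N+2)), at most q from index n on. *)
Lemma pow_fact_ratio x n i (q : R) : 0 <= x -> 0 <= q ->
  x ^+ 2 <= q * (n.+1 * n.+2)%:R ->
  x ^+ (n + i.*2) / (n + i.*2)`!%:R <= x ^+ n / n`!%:R * q ^+ i.
Proof.
move=> x0 q0 h; elim: i => [|i IH]; first by rewrite addn0 expr0 mulr1.
have -> : (n + i.+1.*2 = (n + i.*2).+2)%N by lia.
rewrite !exprS !factS !natrM.
set N := (n + i.*2)%N; set F := N`!%:R; set P := x ^+ N.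
have -> : x * (x * P) / (N.+2%:R * (N.+1%:R * F)) = P / F * (x ^+ 2 / (N.+2%:R * N.+1%:R)).
  by rewrite expr2 !invfM; ring.
rewrite [q * _]mulrC [in leRHS]mulrA; apply: ler_pM => //.
- by rewrite divr_ge0 ?exprn_ge0.
- by rewrite divr_ge0 ?sqr_ge0 // mulr_ge0.
- rewrite ler_pdivrMr ?mulr_gt0 ?ltr0n // (le_trans h) // ler_wpM2l //.
  by rewrite -natrM ler_nat mulnC leq_mul // ltnS /N leq_addr.
Qed.

Lemma cos_tail_le1 x m q : 0 <= q < 1 -> x ^+ 2 <= q * (m.*2.+1 * m.*2.+2)%:R ->
  `|series (cos_coeff' x) m - cos x| <= `|x| ^+ m.*2 / m.*2`!%:R / (1 - q).
Proof.
move=> q01 h; apply: cos_tail_le => // i; rewrite doubleD.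
by apply: pow_fact_ratio; rewrite ?normr_ge0 ?(andP q01).1 // real_normK ?num_real.
Qed.

Lemma sin_tail_le1 x m q : 0 <= q < 1 -> x ^+ 2 <= q * (m.*2.+2 * m.*2.+3)%:R ->
  `|series (sin_coeff' x) m - sin x| <= `|x| ^+ m.*2.+1 / m.*2.+1`!%:R / (1 - q).
Proof.
move=> q01 h; apply: sin_tail_le => // i; rewrite doubleD -addSn.
by apply: pow_fact_ratio; rewrite ?normr_ge0 ?(andP q01).1 // real_normK ?num_real.
Qed.

(** For |x| <= 4, |x|^j / j! = 2^-j (2|x|)^j / j! <= e^8 / 2^j. The bound is crude but uniform in x,
    and is the origin of every later e^8. *)
Lemma cos_tail_le2 x m : `|x| <= 4 ->
  `|series (cos_coeff' x) m - cos x| <= 2 * expR 8 / 4 ^+ m.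
Proof.
move=> x4; have := @cos_tail_le x m (expR 8 / 4 ^+ m) 4^-1.
move=> /(_ _ _)/le_trans; apply.
- by apply/andP; split; lra.
- move=> i; rewrite -mulrA -exprVn -exprD.
  have -> : (4^-1 : R) ^+ (m + i) = 2^-1 ^+ (m + i).*2.
    by rewrite -mul2n exprM; congr (_ ^+ _); field.
  set n := (_.*2)%N; rewrite exprVn ler_pdivlMr ?exprn_gt0 //.
  rewrite mulrAC -exprMn; apply: le_trans (expR_ge_term n _) => //.
  rewrite ler_pM2r ?invr_gt0 ?ltr0n ?fact_gt0 //.
  by apply: lerXn2r; rewrite ?nnegrE ?mulr_ge0 //; lra.
- have : 0 <= expR 8 / 4 ^+ m :> R by rewrite divr_ge0 ?expR_ge0 ?exprn_ge0.
  move=> u0; rewrite -[in leRHS]mulrA; move: (expR 8 / 4 ^+ m) u0 => u u0.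
  by have -> : (1 - 4^-1)^-1 = 4/3 :> R by [field]; lra.
Qed.

Lemma sin_tail_le2 x m : `|x| <= 4 ->
  `|series (sin_coeff' x) m - sin x| <= 2 * expR 8 / 4 ^+ m.
Proof.
move=> x4; have := @sin_tail_le x m (expR 8 / 4 ^+ m) 4^-1.
move=> /(_ _ _)/le_trans; apply.
- by apply/andP; split; lra.
- move=> i; rewrite -mulrA -exprVn -exprD.
  have -> : (4^-1 : R) ^+ (m + i) = 2^-1 ^+ (m + i).*2.
    by rewrite -mul2n exprM; congr (_ ^+ _); field.
  apply: (@le_trans _ _ (expR 8 * 2^-1 ^+ (m + i).*2.+1)); last first.
    rewrite ler_pM2l ?expR_gt0 // exprS ler_piMl ?exprn_ge0 //; lra.
  set n := (_.*2.+1)%N; rewrite exprVn ler_pdivlMr ?exprn_gt0 //.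
  rewrite mulrAC -exprMn; apply: le_trans (expR_ge_term n _) => //.
  rewrite ler_pM2r ?invr_gt0 ?ltr0n ?fact_gt0 //.
  by apply: lerXn2r; rewrite ?nnegrE ?mulr_ge0 //; lra.
- have : 0 <= expR 8 / 4 ^+ m :> R by rewrite divr_ge0 ?expR_ge0 ?exprn_ge0.
  move=> u0; rewrite -[in leRHS]mulrA; move: (expR 8 / 4 ^+ m) u0 => u u0.
  by have -> : (1 - 4^-1)^-1 = 4/3 :> R by [field]; lra.
Qed.

(** Three terms of the series show cos (3/2) > 0, and cos decreases to its zero at pi/2. The upper
    bound on pi comes in the same way from cos (8/5) < 0. *)
Lemma pi_ge3 : 3 <= pi :> R.
Proof.
have c_sgn : 0 < cos (3/2) :> R.
  have normx : `|3/2| = 3/2 :> R by rewrite ger0_norm //; lra.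
  have q01 : (0 <= 10^-1 :> R) && (10^-1 < 1 :> R) by apply/andP; split; lra.
  have h : (3/2) ^+ 2 <= 10^-1 * (3.*2.+1 * 3.*2.+2)%:R :> R.
    by rewrite (_ : (_ * _)%N = 56%N) //; lra.
  have := cos_tail_le1 q01 h; rewrite normx.
  have -> : (1 - 10^-1)^-1 = 10/9 :> R by field.
  rewrite /series /= !big_nat_recr ?big_geq //= /cos_coeff' /= !factS fact0.
  by rewrite ler_norml => /andP[]; lra.
have pi2 := @pi_ge2 R.
suff : 3/2 < pi / 2 :> R by lra.
by rewrite -ltr_cos ?cos_pihalf // in_itv /=; apply/andP; split; lra.
Qed.

Lemma pi_le16div5 : pi <= 16/5 :> R.
Proof.
have c_sgn : cos (8/5) < 0 :> R.
  have normx : `|8/5| = 8/5 :> R by rewrite ger0_norm //; lra.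
  have q01 : (0 <= 10^-1 :> R) && (10^-1 < 1 :> R) by apply/andP; split; lra.
  have h : (8/5) ^+ 2 <= 10^-1 * (4.*2.+1 * 4.*2.+2)%:R :> R.
    by rewrite (_ : (_ * _)%N = 90%N) //; lra.
  have := cos_tail_le1 q01 h; rewrite normx.
  have -> : (1 - 10^-1)^-1 = 10/9 :> R by field.
  rewrite /series /= !big_nat_recr ?big_geq //= /cos_coeff' /= !factS fact0.
  by rewrite ler_norml => /andP[]; lra.
have pi2 := @pi_ge2 R.
suff : pi / 2 < 8/5 :> R by lra.
by rewrite -ltr_cos ?cos_pihalf // in_itv /=; apply/andP; split; lra.
Qed.

End TrigTails.

(** * The periodic regime *)

Section Amplitude.
Variable R : realType.
Implicit Types (z : R) (u : R^nat) (n m k i : nat).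

Local Notation rho := (100/101 : R).
Local Notation mu := (101/100 : R).

(* Taylor coefficients of sinh (pi s) / (pi s), in the variable s ^ 2. *)
Definition sinhc k : R := pi ^+ k.*2 / k.*2.+1`!%:R.

(* Coefficients of the quotient of that series by 1 + s ^ 2, that is, without its
   zeros s = +i, -i: they are the poles of the generating function nearest 0. *)
Fixpoint sinhq k : R :=
  if k is k'.+1 then sinhc k - sinhq k' else 1.

Definition shifted_cos z n : R := cos (z - n%:R * (pi / 2)).

(** * Size of the quotient coefficients *)

Lemma pi_sqr_bounds : (9 <= pi ^+ 2 :> R) && (pi ^+ 2 <= 256/25 :> R).
Proof.
have p3 := @pi_ge3 R; have p4 := @pi_le16div5 R.
by rewrite expr2; apply/andP; split; nra.
Qed.

(** Unfolded, the recursion gives the alternating partial sums of [sinhc], which are those of the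
    sine series at pi, divided by pi. Since sin pi = 0, each [sinhq k] is up to sign a tail of that
    series. *)
Lemma sinhqE k : (-1) ^+ k * sinhq k = series (sin_coeff' pi) k.+1 / pi.
Proof.
have p0 := lt0r_neq0 (pi_gt0 R).
elim: k => [|k IH] /=.
  by rewrite /series /= big_nat1 /sin_coeff' double0 factS fact0 !expr0 expr1 divr1 !mul1r divff.
rewrite mulrBr [in X in _ - X]exprS -mulrA IH.
rewrite [in RHS]/series /= [in RHS]big_nat_recr //= /series /=.
rewrite /sin_coeff' /sinhc -exprnP !exprS.
set F := (_`!%:R : R); set P := pi ^+ _; set S := (\sum_(_ <= _ < _) _)%R.
have F0 : F != 0 by rewrite pnatr_eq0 -lt0n fact_gt0.
by move: F P S F0 pi p0 => F P S F0 p p0; field; apply/andP.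
Qed.

Lemma norm_sinhq_series k : `|sinhq k| = `|series (sin_coeff' pi) k.+1 - sin pi| / pi.
Proof.
rewrite sinpi subr0 -[X in _ / X](ger0_norm (pi_ge0 R)) -normf_div -sinhqE.
by rewrite normrM normrX normrN1 expr1n mul1r.
Qed.

Lemma norm_sinhq_le k : `|sinhq k| <= expR 8 / 4 ^+ k.
Proof.
have p3 := @pi_ge3 R; have p4 := @pi_le16div5 R.
rewrite norm_sinhq_series ler_pdivrMr ?pi_gt0 //.
apply: (le_trans (sin_tail_le2 _ _)); first by rewrite ger0_norm; lra.
have e0 : 0 <= expR 8 / 4 ^+ k :> R by rewrite divr_ge0 ?expR_ge0 ?exprn_ge0.
rewrite exprS invfM [4^-1 * _]mulrC mulrA -[2 * _ / _]mulrA.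
by move: (expR 8 / _) e0 => e e0; nra.
Qed.

Lemma sinhc1 : sinhc 1 = pi ^+ 2 / 6.
Proof. by rewrite /sinhc (_ : 1.*2.+1`! = 6%N). Qed.

Lemma sinhc2 : sinhc 2 = (pi ^+ 2) ^+ 2 / 120.
Proof. by rewrite /sinhc (_ : 2.*2.+1`! = 120%N) // -exprM. Qed.

Lemma norm_sinhq1 : `|sinhq 1| <= 71/100.
Proof.
have /andP[] := pi_sqr_bounds; rewrite /= sinhc1.
by move: (pi ^+ 2) => w w9 w10; rewrite ger0_norm; lra.
Qed.

Lemma norm_sinhq2 : `|sinhq 2| <= 18/100.
Proof.
have /andP[] := pi_sqr_bounds; rewrite /= sinhc1 sinhc2.
by move: (pi ^+ 2) => w w9 w10; rewrite expr2 ger0_norm; nra.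
Qed.

(** The tail starts at pi^9 / 9! for k = 0, and its ratio is at most 1/10 because pi^2 <= 11. *)
Lemma norm_sinhq3 k : `|sinhq k.+3| <= 35/1000 / 10 ^+ k.
Proof.
have p3 := @pi_ge3 R; have /andP[p9 p10] := pi_sqr_bounds.
have q01 : (0 <= 10^-1 :> R) && (10^-1 < 1 :> R) by apply/andP; split; lra.
rewrite norm_sinhq_series ler_pdivrMr ?pi_gt0 //.
apply: (le_trans (sin_tail_le1 q01 _)).
  apply: (le_trans p10); apply: (@le_trans _ _ (10^-1 * (10 * 11)%:R)); first by lra.
  rewrite ler_pM2l; last by lra.
  by rewrite ler_nat leq_mul.
have -> : (1 - 10^-1)^-1 = 10/9 :> R by field.
rewrite (ger0_norm (pi_ge0 R)).
have := @pow_fact_ratio R pi 9 k 10^-1 (pi_ge0 R) _ _.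
rewrite (_ : 9 + k.*2 = k.+4.*2.+1)%N; last by lia.
have h0 : (0 : R) <= 10^-1 by lra.
have h1 : pi ^+ 2 <= 10^-1 * (10 * 11)%:R :> R.
  by rewrite (_ : (_ * _)%N = 110%N) //; lra.
move=> /(_ h0 h1) h; rewrite -exprVn.
apply: (@le_trans _ _ (pi ^+ 9 / 9`!%:R * 10^-1 ^+ k * (10/9))).
  by rewrite ler_pM2r //; lra.
have p8 : pi ^+ 8 <= 110 * 100 :> R.
  rewrite (exprM _ 2 4).
  move: (pi ^+ 2) p9 p10 => w w9 w10; rewrite (exprM _ 2 2).
  have : w ^+ 2 <= (256/25) ^+ 2 by apply: lerXn2r; rewrite ?nnegrE //; lra.
  have : 0 <= w ^+ 2 by rewrite sqr_ge0.
  move: (w ^+ 2) => v v0 v1.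
  have : v ^+ 2 <= ((256/25) ^+ 2) ^+ 2 by apply: lerXn2r; rewrite ?nnegrE //; lra.
  by move: (v ^+ 2) => t; lra.
have -> : 9`!%:R = 72 * 72 * 70 :> R by rewrite !factS fact0 !natrM; ring.
rewrite exprS; have t0 : (0 : R) <= 10^-1 ^+ k by rewrite exprn_ge0.
have e0 : 0 <= pi ^+ 8 :> R by rewrite exprn_ge0 ?pi_ge0.
have p0 := @pi_ge0 R.
move: pi (pi ^+ 8) (10^-1 ^+ k) t0 e0 p8 p0 => p e t t0 e0 e1 p0.
have -> : p * e / (72 * 72 * 70) * t * (10 / 9) = e / (72 * 72 * 70) * (10 / 9) * (t * p).
  by ring.
rewrite -[35 / 1000 * t * p]mulrA ler_wpM2r ?mulr_ge0 //.
by lra.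
Qed.

(** This is the contraction: 0.71 * 1.01 + 0.18 * 1.01^2 + 0.05 < 0.96. The weights [mu ^+ k], with
    [mu] the inverse of [rho], pay for the weaker bound [rho ^+ (n./2 - k)] available at the earlier
    indices. *)
Lemma sum_norm_sinhq m : \sum_(k < m) `|sinhq k.+1| * mu ^+ k.+1 <= 96/100.
Proof.
have n1 := norm_sinhq1; have n2 := norm_sinhq2.
have geo i : \sum_(k < i) `|sinhq k.+3| * mu ^+ k.+3
             <= 5/100 * (1 - (101/1000) ^+ i) :> R.
  elim: i => [|i IH]; first by rewrite big_ord0 expr0 subrr mulr0.
  rewrite big_ord_recr /=; apply: (le_trans (lerD IH (ler_wpM2r _ (norm_sinhq3 i)))).
    by apply: exprn_ge0; lra.
  rewrite [mu ^+ i.+3](exprD _ 3 i) [(101/1000) ^+ i.+1]exprS -exprVn.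
  have -> : 35 / 1000 * 10^-1 ^+ i * (mu ^+ 3 * mu ^+ i) =
            35/1000 * mu ^+ 3 * (10^-1 * mu) ^+ i by rewrite mulrACA -exprMn.
  rewrite (_ : 10^-1 * mu = 101/1000); last by field.
  have : 0 <= (101/1000) ^+ i :> R by apply: exprn_ge0; lra.
  by move: ((101/1000) ^+ i) => t t0; lra.
case: m => [|[|m]]; first by rewrite big_ord0; lra.
  by rewrite big_ord1 expr1; lra.
rewrite 2!big_ord_recl /= /bump /= expr1.
rewrite (eq_bigr (fun k : 'I_m => `|sinhq k.+3| * mu ^+ k.+3)) //.
have := geo m; have : 0 <= (101/1000) ^+ m :> R by apply: exprn_ge0; lra.
move: ((101/1000) ^+ m) (\sum_(k < m) _) => t S t0 hS.
rewrite -/(sinhq 1) -/(sinhq 2).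
rewrite addn0.
by move: `|sinhq 1| `|sinhq 2| n1 n2 => a b a1 b1; lra.
Qed.


(** Coefficient of s^n in e^(zs) / (1 + s^2), written as a signed partial sum of the sine or cosine
    series. *)
Definition trig_partial z n : R := (-1) ^+ n./2 *
  (if odd n then series (sin_coeff' z) n./2.+1 else series (cos_coeff' z) n./2.+1).

Lemma trig_partialSS z n :
  trig_partial z n.+2 + trig_partial z n = z ^+ n.+2 / n.+2`!%:R.
Proof.
have sgn k : (-1) ^+ k.+1 * (-1) ^+ k.+1 = 1 :> R by rewrite -exprMn mulrNN mulr1 expr1n.
rewrite /trig_partial /= negbK -[in X in _ = X / _](odd_double_half n).
rewrite -[in X in _ = _ / X](odd_double_half n).
case: (odd n); rewrite [series _ _.+2]/series /= big_nat_recr //= mulrDr.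
- rewrite /sin_coeff' -exprnP mulrA mulrA sgn mul1r exprS mulN1r /series /= mulNr.
  by rewrite addrAC addNr add0r add1n.
- rewrite /cos_coeff' -exprnP mulrA mulrA sgn mul1r exprS mulN1r /series /= mulNr.
  by rewrite addrAC addNr add0r add0n.
Qed.

Lemma shifted_cosSS z n : shifted_cos z n.+2 = - shifted_cos z n.
Proof.
rewrite /shifted_cos -[in RHS](subrK pi (z - _)) cosDpi opprK; congr cos.
by rewrite -addn2 natrD; field.
Qed.

Lemma shifted_cosE z n : shifted_cos z n =
  (-1) ^+ n./2 * (if odd n then sin z else cos z).
Proof.
have [m] := ubnP n; elim: m n => // m IH [|[|n]] lt_n.
- by rewrite /shifted_cos mul0r subr0 expr0 mul1r.
- by rewrite /shifted_cos mul1r cosBpihalf expr0 mul1r.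
- by rewrite shifted_cosSS IH; [rewrite /= negbK exprS mulN1r mulNr|lia].
Qed.

Lemma shifted_cos_sub z n k : (k <= n./2)%N ->
  shifted_cos z (n - k.*2)%N = (-1) ^+ k * shifted_cos z n.
Proof.
move=> le_k; rewrite !shifted_cosE mulrA.
have -> : odd (n - k.*2) = odd n by lia.
congr (_ * _); rewrite -exprD.
have -> : ((k + n./2) = (n - k.*2)./2 + k.*2)%N by lia.
by rewrite exprD -[k.*2]mul2n exprM sqrrN !expr1n mulr1.
Qed.

Lemma trig_partial_tail z n : `|z| <= pi ->
  `|trig_partial z n - shifted_cos z n| <= expR 8 / 4 ^+ n./2.
Proof.
move=> zpi; have z4 : `|z| <= 4 by have := @pi_le16div5 R; lra.
rewrite shifted_cosE /trig_partial -mulrBr normrM normrX normrN1 expr1n mul1r.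
have e0 : 0 <= expR 8 / 4 ^+ n./2 :> R by rewrite divr_ge0 ?expR_ge0 ?exprn_ge0.
apply: (@le_trans _ _ (2 * expR 8 / 4 ^+ n./2.+1)).
  by case: (odd n); [exact: sin_tail_le2 | exact: cos_tail_le2].
rewrite exprS invfM [4^-1 * _]mulrC mulrA -[2 * _ / _]mulrA.
by move: (expR 8 / _) e0 => e e0; lra.
Qed.

(** The left side tends to the value of the quotient at s^2 = -1, a quotient of two vanishing
    functions there. This identity replaces l'Hopital's rule: the first term tends to 0 and the
    second to - cos pi / 2 = 1/2. *)
Lemma sum_alt_sinhq m : \sum_(k < m.+1) (-1) ^+ k * sinhq k =
  (m%:R + 3/2) * ((-1) ^+ m * sinhq m) - series (cos_coeff' pi) m.+1 / 2.
Proof.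
elim: m => [|m IH].
  rewrite big_ord1 /series /= big_nat1 /cos_coeff' double0 fact0 -exprnP !expr0.
  by rewrite /= invr1; lra.
rewrite big_ord_recr IH [in RHS]/series [in RHS]/= [in RHS]big_nat_recr //=.
set A := (-1) ^+ m.+1 * sinhc m.+1.
have -> : (-1) ^+ m.+1 * (sinhc m.+1 - sinhq m) = A + (-1) ^+ m * sinhq m.
  by rewrite /A mulrBr exprS !mulN1r !mulNr opprK.
have -> : cos_coeff' pi m.+1 = (m.+1.*2.+1)%:R * A.
  rewrite /A /cos_coeff' /sinhc -exprnP factS natrM invfM.
  move: (pi ^+ _) (_ ^+ _) (_`!%:R)^-1 => P s F.
  have : (m.+1.*2.+1)%:R != 0 :> R by rewrite pnatr_eq0.
  by move: (_.+1%:R) => N N0; field.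
have -> : (m.+1.*2.+1)%:R = 2 * m%:R + 3 :> R.
  by rewrite -[3]/(3%:R) -natrM -natrD; congr _%:R; lia.
rewrite -[m.+1%:R]natr1 /series /=.
move: (\sum_(_ <= _ < _) _) ((-1) ^+ m * sinhq m) (m%:R : R) A => c p k B.
by field.
Qed.

Lemma sum_alt_sinhq_lim m :
  `|1 - 2 * \sum_(k < m.+1) (-1) ^+ k * sinhq k| <= 6 * expR 8 * rho ^+ m.
Proof.
have p4 := @pi_le16div5 R; have p3 := @pi_ge3 R.
have : `|series (cos_coeff' pi) m.+1 + 1| <= 2 * expR 8 / 4 ^+ m.+1 :> R.
  rewrite -[X in _ + X]opprK -cospi; apply: cos_tail_le2.
  by rewrite ger0_norm ?pi_ge0 //; lra.
have := norm_sinhq_le m.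
have <- : `|(-1) ^+ m * sinhq m| = `|sinhq m|.
  by rewrite normrM normrX normrN1 expr1n mul1r.
rewrite sum_alt_sinhq.
move: (series _ _) ((-1) ^+ m * _) => c p hp hc.
have -> : 1 - 2 * ((m%:R + 3/2) * p - c / 2) = (c + 1) - (2 * m%:R + 3) * p by field.
apply: (le_trans (ler_normB _ _)); rewrite normrM.
have e0 := @expR_gt0 R 8.
(* The linear factor in m is absorbed by one of the two factors 2^-m of 4^-m. *)
have m1 : m%:R + 1 <= 2 ^+ m :> R by rewrite natr1 -natrX ler_nat ltn_expl.
have m0 : 0 <= m%:R :> R by [].
have q0 : 0 <= 2^-1 ^+ m :> R by apply: exprn_ge0; lra.
have q1 : 2 ^+ m * 2^-1 ^+ m = 1 :> R by rewrite -exprMn divff // expr1n.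
have -> : `|2 * m%:R + 3| = 2 * m%:R + 3 :> R by rewrite ger0_norm //; lra.
have E : 4 ^- m = 2^-1 ^+ m * 2^-1 ^+ m :> R.
  by rewrite -exprMn -exprVn; congr (_ ^+ _); field.
have rq : 2^-1 ^+ m <= rho ^+ m by apply: lerXn2r; rewrite ?nnegrE; lra.
apply: (@le_trans _ _ (6 * expR 8 * 2^-1 ^+ m)); last first.
  by rewrite ler_wpM2l // mulr_ge0 // ltW.
rewrite exprS invfM E in hc; rewrite E in hp.
move: (2^-1 ^+ m) (2 ^+ m) (m%:R) (expR 8) q0 q1 m1 m0 e0 hc hp {rq E}.
move=> q Q k e q0 q1 m1 m0 e0 hc hp.
have hp' : (2 * k + 3) * `|p| <= (2 * k + 3) * (e * (q * q)).
  by apply: ler_wpM2l => //; lra.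
have kq : (k + 1) * q <= 1 by rewrite -[leRHS]q1 ler_wpM2r.
have : e * q * ((k + 1) * q) <= e * q by rewrite ler_piMr // mulr_ge0 // ltW.
have q_le1 : q <= 1 by apply: le_trans kq; rewrite ler_peMl //; lra.
have : e * q * q <= e * q by rewrite ler_piMr // mulr_ge0 // ltW.
have -> : 6 * e * q = 6 * (e * q) by ring.
move: hc hp'; have -> : 2 * e * (4^-1 * (q * q)) = 2^-1 * (e * q * q) by field.
have -> : (2 * k + 3) * (e * (q * q)) = 2 * (e * q * ((k+1) * q)) + e * q * q by ring.
have : 0 <= e * q by rewrite mulr_ge0 // ltW.
move: (e * q) (e * q * q) (e * q * ((k + 1) * q)) ((2 * k + 3) * `|p|) `|c + 1|.
by move=> *; lra.
Qed.

Section Recurrence.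
Variables (u : R^nat) (z : R).
Hypothesis z_le_pi : `|z| <= pi.
Hypothesis u_conv : forall n,
  \sum_(k < n./2.+1) sinhc k * u (n - k.*2)%N = z ^+ n / n`!%:R.

(** Both sides of [u_conv] are divided by 1 + s^2: adding the claims for n and n+2 restores
    [u_conv], since consecutive [sinhq] add up to [sinhc]. *)
Lemma sinhq_conv n :
  \sum_(k < n./2.+1) sinhq k * u (n - k.*2)%N = trig_partial z n.
Proof.
have sinhc0 : sinhc 0 = 1 by rewrite /sinhc double0 expr0 divr1.
have [m] := ubnP n; elim: m n => // m IH [|[|n]] lt_n.
- have := u_conv 0; rewrite !big_ord1 sinhc0 /= => ->.
  rewrite /trig_partial /series /= big_nat1 /cos_coeff'.
  by rewrite -exprnP double0 !expr0 !mul1r.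
- have := u_conv 1; rewrite !big_ord1 sinhc0 /= => ->.
  rewrite /trig_partial /series /= big_nat1 /sin_coeff'.
  by rewrite -exprnP double0 expr0 !mul1r.
apply: (addIr (trig_partial z n)); rewrite trig_partialSS -u_conv -IH; last by lia.
rewrite [in RHS]big_ord_recl big_ord_recl sinhc0 -addrA; congr (_ + _).
rewrite -big_split /=; apply: eq_bigr => k _.
by rewrite /bump /= add1n doubleS !subSS mulrBl subrK.
Qed.

(** Twice the shifted cosine solves the divided equation up to a small error, so the difference [d]
    satisfies it with right side at most 7 e^8 rho^(n/2). Strong induction closes because 7 + 0.96 *
    175 = 175. *)
Lemma shifted_cos_amplitude n :
  `|u n - 2 * shifted_cos z n| <= 175 * expR 8 * rho ^+ n./2.
Proof.
have e0 := @expR_gt0 R 8.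
have rho0 j : 0 <= rho ^+ j by apply: exprn_ge0; lra.
have [m] := ubnP n; elim: m n => // m IH n lt_n.
set d := fun n => u n - 2 * shifted_cos z n.
have dconv : d n + \sum_(k < n./2) sinhq k.+1 * d (n - k.+1.*2)%N =
    (trig_partial z n - shifted_cos z n)
    + shifted_cos z n * (1 - 2 * \sum_(k < n./2.+1) (-1) ^+ k * sinhq k).
  transitivity (\sum_(k < n./2.+1) sinhq k * d (n - k.*2)%N).
    by rewrite [RHS]big_ord_recl /= mul1r subn0.
  transitivity (trig_partial z n -
      2 * shifted_cos z n * \sum_(k < n./2.+1) (-1) ^+ k * sinhq k); last by ring.
  rewrite -sinhq_conv mulr_sumr -sumrB; apply: eq_bigr => k _.
  by rewrite /d shifted_cos_sub -1?ltnS //; ring.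
rewrite -/(d n) -[d n](addrK (\sum_(k < n./2) sinhq k.+1 * d (n - k.+1.*2)%N)) dconv.
have b1 : `|trig_partial z n - shifted_cos z n| <= expR 8 * rho ^+ n./2.
  apply: (le_trans (trig_partial_tail n z_le_pi)).
  rewrite ler_pM2l // -exprVn; apply: lerXn2r; rewrite ?nnegrE; lra.
have b2 : `|shifted_cos z n * (1 - 2 * \sum_(k < n./2.+1) (-1) ^+ k * sinhq k)|
          <= 6 * expR 8 * rho ^+ n./2.
  rewrite normrM -[leRHS]mul1r; apply: ler_pM => //; first exact: cos_max.
  exact: sum_alt_sinhq_lim.
have b3 : `|\sum_(k < n./2) sinhq k.+1 * d (n - k.+1.*2)%N|
    <= 175 * expR 8 * rho ^+ n./2 * (96/100).
  apply: (le_trans (ler_norm_sum _ _ _)).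
  apply: (@le_trans _ _ (175 * expR 8 * rho ^+ n./2 *
      \sum_(k < n./2) `|sinhq k.+1| * mu ^+ k.+1)); last first.
    by rewrite ler_wpM2l ?sum_norm_sinhq // mulr_ge0 // mulr_ge0 // ltW.
  rewrite mulr_sumr; apply: ler_sum => k _.
  have lt_k := ltn_ord k.
  rewrite normrM mulrCA ler_wpM2l //.
  apply: (le_trans (IH (n - k.+1.*2)%N _)); first by lia.
  have -> : (n - k.+1.*2)./2 = (n./2 - k.+1)%N by lia.
  move: (nat_of_ord k) lt_k => j lt_j.
  rewrite -[in leRHS](subnK lt_j) [in leRHS]exprD -!mulrA -exprMn.
  have -> : rho * mu = 1 by field.
  by rewrite expr1n mulr1.
apply: (le_trans (ler_normB _ _)).
apply: (le_trans (lerD (ler_normD _ _) (lexx _))).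
have fin (a b c e q : R) : a <= e * q -> b <= 6 * e * q ->
    c <= 175 * e * q * (96/100) -> a + b + c <= 175 * e * q by move=> *; lra.
exact: fin b1 b2 b3.
Qed.

End Recurrence.
End Amplitude.

(** * The front, by Stirling's formula *)

Section Stirling.
Variable R : realType.
Implicit Types (s t x y : R) (n m k j : nat).

Lemma nondecreasing_from0 (g dg : R -> R) t :
  (forall x, is_derive x 1 g (dg x)) -> (forall x, 0 <= x -> 0 <= dg x) ->
  0 <= t -> g 0 <= g t.
Proof.
move=> hg dg0 t0.
have cg : {within `[0, t], continuous g}.
  by apply: derivable_within_continuous => x _; exact: ex_derive.
have [c] := @MVT_segment R g dg 0 t t0 (fun x _ => hg x) cg.
rewrite in_itv /= => /andP[c0 _] /eqP; rewrite subr_eq => /eqP ->.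
by rewrite lerDr mulr_ge0 ?dg0 // subr_ge0.
Qed.

(** Equivalent to tanh (t/2) <= t/2. *)
Lemma expR_pade_le t : 0 <= t -> 2 * (expR t - 1) <= t * (expR t + 1).
Proof.
move=> t0; pose g (x : R) := x * (expR x + 1) - 2 * (expR x - 1).
have dg x : is_derive x 1 g (1 - expR x + x * expR x).
  rewrite /g; apply: is_derive_eq; rewrite !scaler1 /GRing.scale /=; ring.
have dg0 x : 0 <= x -> 0 <= 1 - expR x + x * expR x.
  move=> x0; have := expR_ge1Dx (- x); have := expRxMexpNx_1 x.
  have := expR_gt0 x; move: (expR x) (expR (- x)) => a b a0 ab hb.
  have : a * (1 - x) <= 1 by rewrite -[leRHS]ab ler_wpM2l // ltW.
  by lra.
have := nondecreasing_from0 dg dg0 t0.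
by rewrite /g expR0 mul0r subrr mulr0 subr0 subr_ge0.
Qed.

(** Equivalent to t <= sinh t. *)
Lemma expR_sinh_ge t : 0 <= t -> 2 * t * expR t <= expR t ^+ 2 - 1.
Proof.
move=> t0; pose g (x : R) := expR x * expR x - 2 * (x * expR x).
have dg x : is_derive x 1 g (2 * expR x * (expR x - 1 - x)).
  rewrite /g; apply: is_derive_eq; rewrite !scaler1 /GRing.scale /=; ring.
have dg0 x : 0 <= x -> 0 <= 2 * expR x * (expR x - 1 - x).
  move=> x0; rewrite mulr_ge0 ?mulr_ge0 ?expR_ge0 //.
  by have := expR_ge1Dx x; lra.
have := nondecreasing_from0 dg dg0 t0.
by rewrite /g expR0 mul0r expr2; lra.
Qed.

(** The two preceding inequalities at t = ln ((n+1)/n); the upper bound is put in telescoping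
    form. *)
Lemma ln_ratio_bounds n : (0 < n)%N ->
  1 <= (n%:R + 2^-1 : R) * (ln n.+1%:R - ln n%:R)
    <= 1 + 4^-1 * (n%:R^-1 - n.+1%:R^-1).
Proof.
move=> n0; have N0 : 0 < n%:R :> R by rewrite ltr0n.
have N1 : 0 < n.+1%:R :> R by rewrite ltr0n.
rewrite -ln_div ?posrE //.
set t := ln _; have et : expR t = n.+1%:R / n%:R by rewrite lnK // posrE divr_gt0.
have t0 : 0 <= t by apply: ln_ge0; rewrite ler_pdivlMr // mul1r ler_nat.
have := expR_pade_le t0; have := expR_sinh_ge t0; rewrite et.
move: N0 N1; rewrite -natr1; move: (n%:R : R) => N N0 N1 h1 h2.
have N0' : N != 0 by rewrite gt_eqF.
have N1' : N + 1 != 0 by rewrite gt_eqF.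
apply/andP; split.
  have : N * (2 * ((N + 1) / N - 1)) <= N * (t * ((N + 1) / N + 1)) by rewrite ler_pM2l.
  have -> : N * (2 * ((N + 1) / N - 1)) = 2 by field.
  have -> : N * (t * ((N + 1) / N + 1)) = 2 * ((N + 2^-1) * t) by field.
  by lra.
have : (N + 2^-1) * N / (2 * (N + 1)) * (2 * t * ((N + 1) / N)) <=
       (N + 2^-1) * N / (2 * (N + 1)) * (((N + 1) / N) ^+ 2 - 1).
  by rewrite ler_wpM2l // divr_ge0 ?mulr_ge0 //; lra.
have -> : (N + 2^-1) * N / (2 * (N + 1)) * (2 * t * ((N + 1) / N)) = (N + 2^-1) * t.
  by field; rewrite N0' N1'.
move=> /le_trans; apply; rewrite le_eqVlt; apply/orP; left; apply/eqP.
by field; rewrite N0' N1'.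
Qed.

Definition lnfact_main n : R := (n%:R + 2^-1) * ln n%:R - n%:R.

Lemma stirling_bounds n : (0 < n)%N ->
  lnfact_main n <= ln n`!%:R <= lnfact_main n + 1.
Proof.
have [D DE] : {D : nat -> R | forall m, D m = ln m`!%:R - lnfact_main m} by eexists.
have DS m : (0 < m)%N -> D m - D m.+1 = (m%:R + 2^-1) * (ln m.+1%:R - ln m%:R) - 1.
  move=> m0; rewrite !DE factS natrM lnM ?posrE ?ltr0n ?fact_gt0 //.
  by rewrite /lnfact_main -natr1; ring.
have D1 : D 1%N = 1 by rewrite DE /lnfact_main ln1 mulr0 !sub0r opprK.
case: n => // n _.
(* The defect [D] starts at 1 and decreases by at most a telescoping sum of total 1/4. *)
suff : 3/4 + 4^-1 * n.+1%:R^-1 <= D n.+1 <= 1.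
  rewrite DE => /andP[h1 h2]; have : 0 <= n.+1%:R^-1 :> R by rewrite invr_ge0.
  by move: (n.+1%:R^-1) h1 h2 => i h1 h2 i0; apply/andP; split; lra.
elim: n => [|n /andP[IH1 IH2]]; first by rewrite D1 invr1; apply/andP; split; lra.
have /andP[] := ln_ratio_bounds (ltn0Sn n).
have := DS n.+1 (ltn0Sn n); move: (_ * (_ - _)) => X.
move: (n.+1%:R^-1) (n.+2%:R^-1) IH1 => a b IH1 h1 h2 h3.
by apply/andP; split; lra.
Qed.

Lemma expR1_ge2 : 2 <= expR 1 :> R.
Proof. by have := expR_ge1Dx (1 : R); lra. Qed.

Lemma expR1_le4 : expR 1 <= 4 :> R.
Proof.
have := expR_ge1Dx (- 2^-1 : R); have := expRxMexpNx_1 (2^-1 : R).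
have -> : expR 1 = expR 2^-1 * expR 2^-1 :> R by rewrite -expRD; congr expR; field.
have := expR_gt0 (2^-1 : R); move: (expR 2^-1) (expR (- 2^-1)) => a b a0 ab hb.
have : a * 2^-1 <= 1 by rewrite -[leRHS]ab ler_pM2l //; lra.
by move=> a2; nra.
Qed.

(* Main term of the abscissa beyond which [n * x^(n-1)] dominates the periodic
   part of [B_n]; both grow like [n! / (2 pi)^n] there. *)
Definition front n : R :=
  n%:R / (2 * pi * expR 1) + ln n%:R / (4 * pi * expR 1).

Definition scaled_pow n x : R := (2 * pi * x) ^+ n / n`!%:R.

(** To the power n, the bracket is about sqrt n * e^(2 pi e c): the logarithmic term of [front]
    accounts for the factor sqrt n of Stirling's formula, and a shift by c for a constant factor. *)
Lemma frontE n c : (0 < n)%N ->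
  2 * pi * (front n + c) = n%:R * expR (- 1) *
    (1 + (ln n%:R / 2 + 2 * pi * expR 1 * c) / n%:R).
Proof.
move=> n0; have N0 : n%:R != 0 :> R by rewrite pnatr_eq0 -lt0n.
have := lt0r_neq0 (pi_gt0 R); have := lt0r_neq0 (expR_gt0 (1 : R)).
rewrite expRN /front; move: pi (expR 1) (n%:R) (ln n%:R) N0 => p e N l N0 e0 p0.
by field; rewrite e0 p0 N0.
Qed.

Lemma scaled_pow_gt0 n x : 0 < x -> 0 < scaled_pow n x.
Proof.
by move=> x0; rewrite divr_gt0 ?exprn_gt0 ?mulr_gt0 ?pi_gt0 ?ltr0n ?fact_gt0.
Qed.

Lemma scaled_pow_le n x y : 0 <= x <= y -> scaled_pow n x <= scaled_pow n y.
Proof.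
move=> /andP[x0 xy]; rewrite ler_pM2r ?invr_gt0 ?ltr0n ?fact_gt0 //.
have p0 := pi_ge0 R.
have y0 := le_trans x0 xy.
by apply: lerXn2r; rewrite ?nnegrE ?mulr_ge0 // ler_wpM2l // mulr_ge0.
Qed.

Lemma expn_main n : (0 < n)%N -> (n%:R * expR (- 1)) ^+ n = expR (n%:R * ln n%:R - n%:R) :> R.
Proof.
move=> n0; have N0 : 0 < n%:R :> R by rewrite ltr0n.
rewrite -[X in X * expR _](lnK (x := n%:R)) ?posrE // -expRD -expRM_natl.
by congr expR; ring.
Qed.

(** By 1 + v <= e^v and Stirling's lower bound, the shift by -1 leaves the factor e^(- 2 pi e), well
    below 1/4. *)
Lemma scaled_pow_front_le n : (0 < n)%N -> 0 <= front n - 1 ->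
  scaled_pow n (front n - 1) <= 4^-1.
Proof.
move=> n0 x0; have N0 : 0 < n%:R :> R by rewrite ltr0n.
have F0 : 0 < n`!%:R :> R by rewrite ltr0n fact_gt0.
have /andP[st _] := stirling_bounds n0.
rewrite /scaled_pow frontE // ler_pdivrMr //.
set v := (_ / _ + _) / _.
have v0 : 0 <= 1 + v.
  have : 0 <= 2 * pi * (front n - 1) by rewrite !mulr_ge0 ?pi_ge0.
  by rewrite frontE // pmulr_rge0 // mulr_gt0 ?expR_gt0.
rewrite exprMn expn_main //.
have : (1 + v) ^+ n <= expR (n%:R * v).
  by rewrite expRM_natl; apply: lerXn2r; rewrite ?nnegrE ?expR_ge0 ?expR_ge1Dx.
move=> /(ler_wpM2l (expR_ge0 (n%:R * ln n%:R - n%:R))) /le_trans; apply.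
rewrite -expRD.
have -> : n%:R * ln n%:R - n%:R + n%:R * v = lnfact_main n - 2 * pi * expR 1.
  by rewrite /v /lnfact_main; field; rewrite gt_eqF.
rewrite -(lnK (x := n`!%:R)) ?posrE // expRB mulrC.
apply: ler_pM; rewrite ?invr_ge0 ?expR_ge0 ?ler_expR //.
rewrite lef_pV2 ?posrE ?expR_gt0 //.
apply: le_trans (expR_ge1Dx _).
have p3 := @pi_ge3 R; have e2 := expR1_ge2; nra.
Qed.

Lemma ln_half_sqr_le n : (0 < n)%N -> (ln n%:R / 2) ^+ 2 <= n%:R :> R.
Proof.
move=> n0; have N0 : 0 < n%:R :> R by rewrite ltr0n.
have h0 : 0 <= ln n%:R / 2 :> R by rewrite divr_ge0 // ln_ge0 // ler1n.
rewrite -[leRHS](lnK (x := n%:R)) ?posrE //.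
set h := ln _ / 2 in h0 *.
have -> : ln n%:R = h + h by rewrite /h; field.
rewrite expRD -expr2; apply: lerXn2r; rewrite ?nnegrE ?expR_ge0 //.
by have := expR_ge1Dx h; lra.
Qed.

Lemma expR_sub_sqr_le x : 0 <= x -> expR (x - x ^+ 2) <= 1 + x.
Proof.
move=> x0; have x1 : 0 < 1 + x by lra.
have := expR_ge1Dx (- (x / (1 + x))).
have -> : 1 - x / (1 + x) = (1 + x)^-1 by field; rewrite gt_eqF.
rewrite expRN lef_pV2 ?posrE ?expR_gt0 //; apply: le_trans.
rewrite ler_expR ler_pdivlMr //.
rewrite -subr_ge0; have -> : x - (x - x ^+ 2) * (1 + x) = x ^+ 3 by ring.
exact: exprn_ge0.
Qed.

(** The shift by 2 contributes c = 4 pi e >= 24 to the exponent. The quadratic loss in (1 + v)^n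
    costs at most 3 and Stirling's upper bound 1, leaving e^(c - 4). *)
Lemma scaled_pow_front_ge : exists N, forall n, (N <= n)%N ->
  10 <= scaled_pow n (front n + 2).
Proof.
pose c : R := 4 * pi * expR 1.
exists (Num.truncn (2 * c ^+ 2)).+1 => n le_n.
have n0 : (0 < n)%N by apply: leq_trans le_n.
have N0 : 0 < n%:R :> R by rewrite ltr0n.
have F0 : 0 < n`!%:R :> R by rewrite ltr0n fact_gt0.
have cn : 2 * c ^+ 2 <= n%:R by apply/ltW/(lt_le_trans (truncnS_gt _)); rewrite ler_nat.
have c24 : 24 <= c.
  by rewrite /c; have p3 := @pi_ge3 R; have e2 := expR1_ge2; nra.
have /andP[_ st] := stirling_bounds n0.
have lsq := ln_half_sqr_le n0.
have l0 : 0 <= ln n%:R / 2 :> R by rewrite divr_ge0 // ln_ge0 // ler1n.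
rewrite /scaled_pow frontE // ler_pdivlMr //.
have -> : 2 * pi * expR 1 * 2 = c by rewrite /c; ring.
have [l lE] : {l : R | ln n%:R / 2 = l} by eexists.
rewrite lE in l0 lsq *.
set v := (l + c) / n%:R.
have v0 : 0 <= v by rewrite divr_ge0 //; lra.
rewrite exprMn expn_main //.
have : expR (n%:R * (v - v ^+ 2)) <= (1 + v) ^+ n.
  by rewrite expRM_natl; apply: lerXn2r; rewrite ?nnegrE ?expR_ge0 ?expR_sub_sqr_le //; lra.
move=> /(ler_wpM2l (expR_ge0 (n%:R * ln n%:R - n%:R))); apply: le_trans.
(* (l + c)^2 <= 2 l^2 + 2 c^2 <= 2 n + n. *)
have vsq : n%:R * v ^+ 2 <= 3.
  have -> : n%:R * v ^+ 2 = (l + c) ^+ 2 / n%:R by rewrite /v; field; rewrite gt_eqF.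
  rewrite ler_pdivrMr //; have := sqr_ge0 (l - c); rewrite sqrrB sqrrD.
  by move: lsq cn; move: (l ^+ 2) (c ^+ 2) (l * c) => a b d; lra.
have nv : n%:R * v = l + c by rewrite /v; field; rewrite gt_eqF.
rewrite -(lnK (x := n`!%:R)) ?posrE // -expRD.
apply: (@le_trans _ _ (expR (c - 4) * expR (lnfact_main n + 1))).
  apply: ler_pM; rewrite ?expR_ge0 ?ler_expR //.
  by apply: le_trans (expR_ge1Dx _); lra.
rewrite -expRD ler_expR mulrBr nv /lnfact_main mulrDl.
have -> : 2^-1 * ln n%:R = l by rewrite -lE mulrC.
by move: (n%:R * ln _) vsq; move: (n%:R * v ^+ 2) => X Y; lra.
Qed.

Lemma scaled_pow_small : exists N, forall n, (N <= n)%N -> scaled_pow n 1 <= 4^-1.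
Proof.
have [H hH] : {H : R | H = expR (4 * pi)} by eexists.
have H1 : 1 <= H by rewrite hH; apply: le_trans (expR_ge1Dx _); have := pi_ge0 R; lra.
exists (Num.truncn (4 * H)).+1 => n le_n.
have Hn : 4 * H <= n%:R by apply/ltW/(lt_le_trans (truncnS_gt _)); rewrite ler_nat.
have : scaled_pow n 1 * 2 ^+ n <= H.
  rewrite /scaled_pow mulrAC -exprMn mulr1 hH.
  have -> : 2 * pi * 2 = 4 * pi :> R by ring.
  by apply: expR_ge_term; have := pi_ge0 R; lra.
have n2 : n%:R <= 2 ^+ n :> R by rewrite -natrX ler_nat ltnW // ltn_expl.
have := scaled_pow_gt0 n ltr01; move: (scaled_pow _ _) => T T0 h.
have : T * (4 * H) <= H.
  by apply: le_trans h; rewrite ler_pM2l //; exact: le_trans n2.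
have -> : T * (4 * H) = (T * 4) * H by ring.
by rewrite ger_pMl; lra.
Qed.

Lemma front_ge4 : exists N, forall n, (N <= n)%N -> 4 <= front n.
Proof.
exists 120 => n le_n.
have n0 : (0 < n)%N by apply: leq_trans le_n.
have := @pi_le16div5 R; have := @pi_ge3 R; have e2 := expR1_ge2; have e4 := expR1_le4.
move=> p3 p4.
have d0 : 0 < 2 * pi * expR 1 :> R by nra.
have d26 : 2 * pi * expR 1 <= 26 :> R by nra.
rewrite /front ler_wpDr //.
  by rewrite divr_ge0 ?ln_ge0 ?ler1n // ?mulr_ge0 ?expR_ge0 ?pi_ge0.
rewrite ler_pdivlMr //; apply: (@le_trans _ _ 120%:R); first by lra.
by rewrite ler_nat.
Qed.

(** Lets a single abscissa serve both a polynomial and its derivative. *)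
Lemma front_step n : (1 < n)%N -> front n - 1 <= front n.-1.
Proof.
case: n => // n; rewrite ltnS => n0 /=.
have N0 : 0 < n%:R :> R by rewrite ltr0n.
have /andP[_ h] := ln_ratio_bounds n0.
have n1 : 1 <= n%:R :> R by rewrite ler1n.
have i1 : n%:R^-1 <= 1 :> R by rewrite invf_le1.
have i0 : 0 <= n.+1%:R^-1 :> R by rewrite invr_ge0.
have l2 : ln n.+1%:R - ln n%:R <= 2 :> R.
  have : 0 <= ln n.+1%:R - ln n%:R :> R by rewrite subr_ge0 ler_ln ?posrE ?ltr0n // ler_nat.
  move: (n%:R : R) (n.+1%:R^-1) (n%:R^-1) (ln n.+1%:R - ln n%:R) h i1 i0 n1.
  by move=> N i' i d h i1 i0 n1 d0; nra.
have p3 := @pi_ge3 R; have e2 := expR1_ge2.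
have d6 : 12 <= 2 * pi * expR 1 :> R by nra.
rewrite /front -natr1.
have -> : 4 * pi * expR 1 = 2 * (2 * pi * expR 1) :> R by ring.
have : 0 < 2 * pi * expR 1 :> R by lra.
move: (2 * pi * expR 1) d6 => d d6 d0.
rewrite lerBlDr -subr_ge0.
have -> : n%:R / d + ln n%:R / (2 * d) + 1 - ((n%:R + 1) / d + ln (n%:R + 1) / (2 * d))
   = (2 * d - 2 - (ln (n%:R + 1) - ln n%:R)) / (2 * d) :> R by field; rewrite gt_eqF.
by rewrite natr1 divr_ge0 //; lra.
Qed.

(** The constant 26 bounds 2 pi e from above; the logarithmic term only helps. *)
Lemma front_gap n j : (j <= n)%N -> (0 < n - j)%N ->
  front (n - j) + j%:R / 26 <= front n.
Proof.
move=> jn n0.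
have := @pi_le16div5 R; have := @pi_ge3 R; have e2 := expR1_ge2; have e4 := expR1_le4.
move=> p3 p4.
have d0 : 0 < 2 * pi * expR 1 :> R by nra.
have d26 : 2 * pi * expR 1 <= 26 :> R by nra.
rewrite /front addrAC lerD //; last first.
  rewrite ler_wpM2r ?invr_ge0 ?mulr_ge0 ?expR_ge0 ?pi_ge0 //.
  by rewrite ler_ln ?posrE ?ltr0n ?ler_nat ?leq_subr // (leq_trans n0) ?leq_subr.
rewrite natrB // mulrBl -addrA gerDl addrC subr_le0.
by rewrite ler_wpM2l // lef_pV2 ?posrE.
Qed.

End Stirling.

(** * Values of Bernoulli polynomials on the real line *)

Section BernoulliValues.
Variables (R : realType) (b : nat -> {poly R}).
Hypothesis b_egf : bernoulli_egf b.
Implicit Types (x y V : R) (n m k i j : nat).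
Local Notation front := (front R).

Definition scaled_val n x : R := (2 * pi) ^+ n * (b n).[x].

Definition wave n x : R := shifted_cos (2 * pi * x) n.

Lemma scaled_val_conv x n :
  \sum_(k < n./2.+1) sinhc R k * scaled_val (n - k.*2) x =
  (2 * pi * (x - 2^-1)) ^+ n / n`!%:R.
Proof.
rewrite exprMn -mulrA -(bernoulli_egf_centered b_egf) mulr_sumr.
apply: eq_bigr => k _; have := ltn_ord k; move: (nat_of_ord k) => {}k lt_k.
rewrite -[in RHS](@subnK k.*2 n); last by lia.
rewrite addnK exprD [(2 * pi) ^+ k.*2]exprMn -[in 2 ^+ _]mul2n exprM.
rewrite /sinhc /scaled_val; have -> : 2 ^+ 2 = 4 :> R by ring.
have : 4 ^+ k != 0 :> R by rewrite expf_neq0.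
rewrite invfM; move: (4 ^+ k) (pi ^+ k.*2) ((2 * pi) ^+ _) => u v w u0.
by move: (_^-1) (_.[x]) => f g; field.
Qed.

Lemma waveD1 n x : wave n (x + 1) = wave n x.
Proof.
rewrite /wave /shifted_cos -[in RHS]cosD2pi; congr cos.
by rewrite -mulr_natl; ring.
Qed.

Lemma wave_reflect n x : wave n (1 - x) = (-1) ^+ n * wave n x.
Proof.
rewrite /wave /shifted_cos -(alternatingn (@cosDpi R)).
rewrite -[in RHS]cosN -[in RHS]cosD2pi; congr cos.
rewrite -[pi *+ 2]mulr_natl -[pi *+ n]mulr_natl.
by move: (@pi R) => p; field.
Qed.

Lemma scaled_val_unit_interval : exists N, forall n x, (N <= n)%N -> 0 <= x <= 1 ->
  `|scaled_val n x + 2 * wave n x| <= 4^-1.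
Proof.
have e0 := @expR_gt0 R 8.
have [N hN] : exists N, forall m, (N <= m)%N -> 175 * expR 8 * (100/101) ^+ m <= 4^-1 :> R.
  have : geometric (175 * expR 8) (100/101 : R) @ \oo --> (0 : R).
    by apply: cvg_geometric; rewrite ger0_norm; lra.
  move=> /cvgr0_norm_le/(_ 4^-1)[]; first by lra.
  by move=> N _ hN; exists N => m /hN /(le_trans (ler_norm _)).
exists N.*2 => n x le_n /andP[x0 x1].
have zpi : `|2 * pi * (x - 2^-1)| <= pi.
  have p0 := pi_ge0 R; rewrite normrM ger0_norm ?mulr_ge0 //.
  have : `|x - 2^-1| <= 2^-1 by rewrite ler_norml; apply/andP; split; lra.
  by move=> h; rewrite mulrAC ler_piMl //; lra.
have := @shifted_cos_amplitude R (fun n => scaled_val n x) _ zpi (scaled_val_conv x) n.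
rewrite /=.
(* The centred argument lags behind 2 pi x by pi, which flips the sign. *)
have -> : shifted_cos (2 * pi * (x - 2^-1)) n = - wave n x.
  rewrite /wave /shifted_cos -[in RHS](subrK pi (_ - _)) cosDpi opprK; congr cos.
  by move: (@pi R) => p; field.
by rewrite mulrN opprK => /le_trans; apply; apply: hN; lia.
Qed.

(** * From the unit interval to the whole line *)

Lemma scaled_val_diff n x : scaled_val n.+1 (x + 1) - scaled_val n.+1 x =
  (2 * pi) ^+ n.+1 * x ^+ n / n`!%:R.
Proof. by rewrite /scaled_val -mulrBr (bernoulli_egf_diff b_egf) mulrA. Qed.

Lemma exprS_diff_le n x y : 0 <= x -> x <= y ->
  (y - x) * (n.+1%:R * x ^+ n) <= y ^+ n.+1 - x ^+ n.+1 <= (y - x) * (n.+1%:R * y ^+ n).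
Proof.
move=> x0 xy; have y0 := le_trans x0 xy.
have const (c : R) : n.+1%:R * c ^+ n = \sum_(i < n.+1) c ^+ n.
  by rewrite sumr_const card_ord mulr_natl.
have split_expr (c : R) i : (i <= n)%N -> c ^+ n = c ^+ (n - i) * c ^+ i.
  by move=> le_in; rewrite -exprD subnK.
have mono k : x ^+ k <= y ^+ k by apply: lerXn2r; rewrite ?nnegrE.
rewrite subrXX !const; apply/andP; split; rewrite ler_wpM2l ?subr_ge0 //;
  apply: ler_sum => i _; rewrite /= (split_expr _ i) -1?ltnS //;
  by apply: ler_pM; rewrite ?exprn_ge0.
Qed.

Lemma expr_factS n x : x ^+ n / n`!%:R = n.+1%:R * x ^+ n / n.+1`!%:R.
Proof. by rewrite factS natrM invfM mulrACA divff ?mul1r ?pnatr_eq0. Qed.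

Lemma scaled_powB n x y : scaled_pow n x - scaled_pow n y =
  (2 * pi) ^+ n * ((x ^+ n - y ^+ n) / n`!%:R).
Proof. by rewrite /scaled_pow -mulrBl !exprMn -mulrBr mulrA. Qed.

(** Comparing n x^(n-1) with increments of x^n makes the sum over unit steps telescope. The
    companion lower bound, one unit behind, telescopes as well. *)
Lemma scaled_val_diff_bounds n x : 0 <= x ->
  0 <= scaled_val n.+1 (x + 1) - scaled_val n.+1 x
    <= scaled_pow n.+1 (x + 1) - scaled_pow n.+1 x.
Proof.
move=> x0; rewrite scaled_val_diff scaled_powB -mulrA.
have P0 : 0 <= (2 * pi) ^+ n.+1 :> R by rewrite exprn_ge0 // mulr_ge0 // pi_ge0.
apply/andP; split; first by rewrite mulr_ge0 // divr_ge0 // exprn_ge0.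
have /andP[h _] := @exprS_diff_le n x (x + 1) x0 ltac:(lra).
rewrite addrAC subrr add0r mul1r in h.
by rewrite ler_wpM2l // expr_factS ler_pM2r // invr_gt0 ltr0n fact_gt0.
Qed.

Lemma scaled_val_diff_ge n x : 1 <= x ->
  scaled_pow n.+1 x - scaled_pow n.+1 (x - 1)
    <= scaled_val n.+1 (x + 1) - scaled_val n.+1 x.
Proof.
move=> x1; rewrite scaled_val_diff scaled_powB -mulrA.
have P0 : 0 <= (2 * pi) ^+ n.+1 :> R by rewrite exprn_ge0 // mulr_ge0 // pi_ge0.
have /andP[_ h] := @exprS_diff_le n (x - 1) x ltac:(lra) ltac:(lra).
rewrite opprB addrCA subrr addr0 mul1r in h.
by rewrite ler_wpM2l // expr_factS ler_pM2r // invr_gt0 ltr0n fact_gt0.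
Qed.

Lemma waveDn n k x : wave n (x + k%:R) = wave n x.
Proof. by elim: k => [|k IH]; rewrite ?addr0 // -natr1 addrA waveD1. Qed.

Lemma wave_le1 n x : `|wave n x| <= 1.
Proof. exact: cos_max. Qed.

Lemma nat_frac x : 0 <= x -> exists k y, 0 <= y <= 1 /\ x = y + k%:R.
Proof.
move=> x0; have /andP[h1 h2] := truncn_itv x0.
exists (Num.truncn x), (x - (Num.truncn x)%:R); rewrite subrK; split=> //.
by rewrite -natr1 in h2; apply/andP; split; lra.
Qed.

(** Climbing by unit steps from [0, 1], the wave is unchanged and the increments add up to at most
    [scaled_pow n x]. *)
Lemma scaled_val_wave : exists N, forall n x, (N <= n)%N -> 0 <= x ->
  `|scaled_val n x + 2 * wave n x| <= 4^-1 + scaled_pow n x.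
Proof.
have [N hN] := scaled_val_unit_interval.
exists N.+1 => -[//|n] x le_n /nat_frac[k [y [y01 ->]]].
have h := hN n.+1 y (leq_trans (leqnSn _) le_n) y01.
have [y0 y1] := andP y01.
have sp0 z : 0 <= z -> 0 <= scaled_pow n.+1 z.
  by move=> z0; rewrite divr_ge0 // exprn_ge0 // !mulr_ge0 // pi_ge0.
rewrite waveDn; elim: k => [|k IH].
  by rewrite addr0 (le_trans h) // lerDl sp0.
rewrite -natr1 addrA.
have := @scaled_val_diff_bounds n (y + k%:R) (addr_ge0 y0 (ler0n _ _)).
move: IH; rewrite !ler_norml.
move: (scaled_val _ (_ + _ + _)) (scaled_val _ _) (scaled_pow _ (_ + _ + _)) (scaled_pow _ _).
by move=> a b' c d /andP[h1 h2] /andP[h3 h4]; apply/andP; split; lra.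
Qed.

(** The loss 9/4 is the amplitude 2 plus the error 1/4 on [0, 1]. *)
Lemma scaled_val_ge : exists N, forall n x, (N <= n)%N -> 1 <= x ->
  scaled_pow n (x - 1) - scaled_pow n 1 - 9/4 <= scaled_val n x.
Proof.
have [N hN] := scaled_val_unit_interval.
exists N.+1 => -[//|n] x le_n x1.
have /nat_frac[k [y [y01 xE]]] : 0 <= x - 1 by lra.
have {xE x1} -> : x = y + k.+1%:R by rewrite -natr1; lra.
have h := hN n.+1 y (leq_trans (leqnSn _) le_n) y01.
have [y0 y1] := andP y01.
elim: k => [|k IH].
  have -> : y + 1%:R - 1 = y by ring.
  have := scaled_pow_le n.+1 y01.
  have := scaled_val_diff_bounds n y0; have := wave_le1 n.+1 y; move: h.
  rewrite !ler_norml; move: (wave _ _) => w.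
  move: (scaled_val _ (_ + _)) (scaled_val _ _) (scaled_pow _ (_ + _)).
  by move=> a b' c /andP[h1 h2] /andP[h3 h4] /andP[h5 h6] h7; lra.
have -> : y + k.+2%:R = y + k.+1%:R + 1 by rewrite -[k.+2%:R]natr1 addrA.
have /(scaled_val_diff_ge n) : 1 <= y + k.+1%:R by rewrite -natr1; have := ler0n R k; lra.
by rewrite addrK; move: IH; lra.
Qed.

Lemma scaled_val_reflect n x : scaled_val n (1 - x) = (-1) ^+ n * scaled_val n x.
Proof. by rewrite /scaled_val (bernoulli_egf_reflect b_egf) mulrCA. Qed.

Lemma scaled_val_wave_sym : exists N, forall n V x, (N <= n)%N ->
  1 - V <= x <= V -> scaled_pow n V <= 4^-1 ->
  `|scaled_val n x + 2 * wave n x| <= 2^-1.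
Proof.
have [N hN] := scaled_val_wave; exists N => n V x le_n /andP[Vx xV] hV.
have pos y : 0 <= y <= V -> `|scaled_val n y + 2 * wave n y| <= 2^-1.
  move=> /[dup] yV /andP[y0 _]; apply: (le_trans (hN _ _ le_n y0)).
  by have := scaled_pow_le n yV; lra.
have [x0|x0] := leP 0 x; first by apply: pos; rewrite x0.
have : 0 <= 1 - x <= V by apply/andP; split; lra.
move=> /pos; rewrite scaled_val_reflect wave_reflect [2 * _]mulrCA -mulrDr.
by rewrite normrM normrX normrN1 expr1n mul1r.
Qed.

(** One unit before x the scaled power is still at least 10, more than 1/4 + 9/4; reflection covers
    the left side. *)
Lemma scaled_val_neq0 : exists N, forall n x, (N <= n)%N ->
  front n + 3 <= x \/ x <= 1 - (front n + 3) -> scaled_val n x != 0.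
Proof.
have [N1 h1] := scaled_val_ge; have [N2 h2] := @scaled_pow_front_ge R.
have [N3 h3] := @scaled_pow_small R; have [N4 h4] := @front_ge4 R.
exists (N1 + N2 + N3 + N4)%N => n x le_n.
have f4 := h4 n ltac:(lia).
have pos y : front n + 3 <= y -> 0 < scaled_val n y.
  move=> hy; have := h1 n y ltac:(lia) ltac:(lra).
  have := h2 n ltac:(lia); have := h3 n ltac:(lia).
  have /(scaled_pow_le n) : 0 <= front n + 2 <= y - 1 by apply/andP; split; lra.
  by lra.
case=> [/pos /lt0r_neq0 //|hx].
have /pos : front n + 3 <= 1 - x by lra.
rewrite scaled_val_reflect; apply: contraTneq => ->.
by rewrite mulr0 ltxx.
Qed.

End BernoulliValues.

(** * Counting the roots *)

Section RealRoots.
Variables (R : realType) (b : nat -> {poly R}).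
Hypothesis b_egf : bernoulli_egf b.
Implicit Types (x y s V : R) (n m k i j : nat).
Local Notation front := (front R).
Local Notation scaled_val := (scaled_val b).

Lemma bernoulli_derivn n j : (j <= n)%N -> derivn j (b n) = b (n - j)%N.
Proof.
by move=> jn; rewrite (appell_derivn (bernoulli_egf0 b_egf) (bernoulli_egf_deriv b_egf)) jn.
Qed.

Lemma bernoulli_neq0 n : b n != 0.
Proof.
have := bernoulli_derivn (leqnn n); rewrite subnn (bernoulli_egf0 b_egf).
by apply: contra_eqN => /eqP ->; rewrite linear0 eq_sym oner_eq0.
Qed.

Lemma root_scaled_val n x : root (b n) x = (scaled_val n x == 0).
Proof.
rewrite /scaled_val mulf_eq0 expf_eq0 mulf_eq0 pnatr_eq0 /= (gt_eqF (pi_gt0 R)).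
by rewrite andbF.
Qed.

(** The offset (n mod 4)/4 cancels the phase n pi/2 up to full periods, so the grid points are
    extrema of the wave. *)
Lemma wave_grid n k i s :
  wave n (- k%:R + (n %% 4)%:R / 4 + i%:R / 2 + s) = (-1) ^+ i * cos (2 * pi * s).
Proof.
rewrite /wave /shifted_cos -(alternatingn (@cosDpi R)).
rewrite -[LHS](periodicn (@cosD2pi R) (k + n %/ 4)%N); congr cos.
rewrite [in n%:R](divn_eq n 4) -[pi *+ 2 *+ _]mulr_natl -[pi *+ 2]mulr_natl.
rewrite -[pi *+ i]mulr_natl !natrD natrM.
by move: (@pi R) => p; field.
Qed.

Lemma cos_small_convex x y z : 0 <= x -> x <= y <= z -> z <= pi ->
  `|cos x| <= 4^-1 -> `|cos z| <= 4^-1 -> `|cos y| <= (4^-1 : R).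
Proof.
move=> x0 /andP[xy yz] zpi; rewrite !ler_norml => /andP[_ h1] /andP[h2 _].
have mono u v : 0 <= u -> u <= v -> v <= pi -> cos v <= cos u :> R.
  move=> u0 uv vpi; rewrite leNgt; apply/negP => cuv.
  have : v < u.
    by rewrite -ltr_cos // in_itv /=; apply/andP; split => //; lra.
  by lra.
have := mono x y x0 xy (le_trans yz zpi); have := mono y z (le_trans x0 xy) yz zpi.
by move=> h3 h4; apply/andP; split; lra.
Qed.

Lemma wave_pred_sqr n x : wave n.+1 x ^+ 2 + wave n x ^+ 2 = 1.
Proof.
rewrite -[RHS](cos2Dsin2 (2 * pi * x - n%:R * (pi / 2))) addrC.
rewrite /wave /shifted_cos; congr (_ + _); congr (_ ^+ 2).
by rewrite -cosBpihalf; congr cos; rewrite -natr1; ring.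
Qed.

(** * The oscillating zone *)

Section Bulk.
Variables (n k : nat).
Let v i : R := - k%:R + (n.+1 %% 4)%:R / 4 + i%:R / 2.
Hypothesis near_wave : forall m x, (m == n) || (m == n.+1) ->
  v 0 <= x <= v (4 * k) -> `|scaled_val m x + 2 * wave m x| <= 2^-1.

Let v_range i s : (i < 4 * k)%N -> 0 <= s <= 2^-1 -> v 0 <= v i + s <= v (4 * k).
Proof.
move=> lt_i /andP[s0 s1]; rewrite /v.
have : i.+1%:R <= (4 * k)%:R :> R by rewrite ler_nat.
by have := ler0n R i; rewrite -natr1 => i0 h; apply/andP; split; lra.
Qed.

Let v_end : (0 < k)%N -> v 0 <= v (4 * k) <= v (4 * k).
Proof.
by move=> k0; rewrite lexx andbT /v; have := ler0n R (4 * k); lra.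
Qed.

Let vS i : v i.+1 = v i + 2^-1.
Proof. by rewrite /v -natr1; ring. Qed.

Let v_sign i : (0 < k)%N -> (i <= 4 * k)%N -> (-1) ^+ i * scaled_val n.+1 (v i) < 0.
Proof.
move=> k0 le_i.
have rg : v 0 <= v i <= v (4 * k).
  move: le_i; rewrite leq_eqVlt => /predU1P[->|lt_i]; first exact: v_end.
  by rewrite -[v i]addr0; apply: v_range => //; apply/andP; split; lra.
have := near_wave (m := n.+1) _ rg; rewrite eqxx orbT => /(_ isT).
rewrite -[v i]addr0 wave_grid mulr0 cos0 mulr1 addr0.
have -> u : `|u| = `|(-1) ^+ i * u| by rewrite normrM normrX normrN1 expr1n mul1r.
rewrite mulrDr [_ * (2 * _)]mulrCA -exprMn mulrNN mulr1 expr1n mulr1.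
rewrite ler_norml => /andP[_].
by lra.
Qed.

Lemma nroots_bulk_ge : (0 < k)%N ->
  (4 * k <= nroots (b n.+1) (fun x => v 0 < x < v (4 * k))%R)%N.
Proof.
move=> k0; apply: nroots_grid_ge (bernoulli_neq0 _) _ _ => i lt_i.
  by rewrite vS; lra.
have := v_sign k0 (ltnW lt_i); have := v_sign k0 lt_i.
rewrite exprS mulN1r mulNr oppr_lt0 => h1 h2.
have c0 : 0 < (2 * pi) ^+ n.+1 :> R by rewrite exprn_gt0 // mulr_gt0 ?pi_gt0.
have : ((-1) ^+ i * scaled_val n.+1 (v i)) * ((-1) ^+ i * scaled_val n.+1 (v i.+1)) < 0.
  by rewrite nmulr_rlt0.
rewrite mulrACA -exprMn mulrNN mulr1 expr1n mul1r /scaled_val mulrACA.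
by rewrite pmulr_rlt0 // mulr_gt0.
Qed.

(** A root in the cell has |cos| <= 1/4, a convex condition on a half-period. Where it holds,
    [wave n] has square at least 15/16, so the derivative [b n] does not vanish, and one Rolle step
    leaves one root, multiplicity included. *)
Let cell_le1 i : (i < 4 * k)%N ->
  (nroots (b n.+1) (fun x => v i <= x <= v i.+1)%R <= 1)%N.
Proof.
move=> lt_i.
have cellP x : v i <= x <= v i.+1 -> v 0 <= x <= v (4 * k).
  rewrite vS => /andP[h1 h2]; rewrite -[x](subrK (v i)) addrC.
  by apply: v_range => //; apply/andP; split; lra.
have waveE x : wave n.+1 x = (-1) ^+ i * cos (2 * pi * (x - v i)).
  by rewrite -(wave_grid n.+1 k) -/(v i) [v i + _]addrC subrK.
pose I x := (v i <= x <= v i.+1) && (`|cos (2 * pi * (x - v i))| <= 4^-1).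
have p0 := @pi_gt0 R.
apply: (@leq_trans (nroots (b n.+1) I)).
  apply: nroots_sub => x; rewrite root_scaled_val => /eqP x0 xc.
  rewrite /I xc /=.
  have := near_wave (m := n.+1) _ (cellP _ xc); rewrite eqxx orbT => /(_ isT).
  rewrite x0 add0r waveE !normrM normrX normrN1 expr1n mul1r normr_nat.
  by lra.
apply: nroots_derivn; rewrite ?bernoulli_derivn ?subSS ?subn0 ?bernoulli_neq0 //.
  move=> x y z /andP[/andP[x1 x2] hx] /andP[/andP[z1 z2] hz] /andP[xy yz].
  rewrite /I (le_trans x1 xy) (le_trans yz z2) /=.
  rewrite vS in z2.
  apply: (@cos_small_convex (2 * pi * (x - v i)) _ (2 * pi * (z - v i))) => //.
  - by rewrite !mulr_ge0 ?subr_ge0 // ltW.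
  - by rewrite !ler_pM2l ?mulr_gt0 // !lerD2r xy yz.
  - by rewrite mulrAC ler_piMl ?pi_ge0 //; lra.
move=> x /andP[xc hx]; rewrite root_scaled_val; apply/negP => /eqP x0.
have := near_wave (m := n) _ (cellP _ xc); rewrite eqxx x0 add0r => /(_ isT).
have := wave_pred_sqr n x; rewrite waveE exprMn sqrr_sign mul1r.
move: hx; rewrite !ler_norml; move: (cos _) (wave n x) => c w.
by move=> /andP[c1 c2] e /andP[w1 w2]; nra.
Qed.

Lemma nroots_bulk_le : (0 < k)%N ->
  (nroots (b n.+1) (fun x => v 0 <= x <= v (4 * k))%R <= 4 * k)%N.
Proof.
move=> k0; rewrite -[leqRHS]muln1; apply: nroots_grid_le; last by rewrite muln_gt0.
exact: cell_le1.
Qed.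

End Bulk.

Lemma nroots_bernoulli : exists N J, forall n, (N <= n)%N ->
  (4 * Num.truncn (front n - 3) <= nroots (b n) xpredT
    <= 4 * Num.truncn (front n - 3) + (J + J))%N.
Proof.
(* The grid ends beyond [front n.+1 - 4], while roots are excluded only from 3 past the front of the
   lowered index: the front must recede by 7. *)
have [J hJ] : exists J, 7 <= J%:R / 26 :> R.
  by exists (7 * 26)%N; rewrite natrM mulfK // pnatr_eq0.
have [N1 h1] := scaled_val_wave_sym b_egf; have [N2 h2] := scaled_val_neq0 b_egf.
have [N3 h3] := @front_ge4 R.
exists (N1 + N2 + N3 + J + 2)%N, J => -[|n] le_n.
  by rewrite addn2 in le_n.
have [n_gt0 le_N1 le_N2 le_N3 lt_J] : [/\ (0 < n)%N, (N1 <= n)%N,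
    (N2 <= n.+1 - J)%N, (N3 <= n)%N & (J < n.+1)%N] by clear -le_n; split; lia.
have f4 := h3 n.+1 (leqW le_N3); have f4' := h3 n le_N3.
have fS : front n.+1 - 1 <= front n := @front_step R n.+1 n_gt0.
pose k := Num.truncn (front n.+1 - 3).
have /andP[k1 k2] : k%:R <= front n.+1 - 3 < k.+1%:R by apply: truncn_itv; lra.
have k0 : (0 < k)%N by rewrite truncn_gt0; lra.
have r0 : 0 <= (n.+1 %% 4)%:R :> R by [].
have r1 : (n.+1 %% 4)%:R <= 3 :> R by rewrite ler_nat -ltnS ltn_mod.
(* Far enough to contain the grid, whose offset is at most 3/4, yet at least 1 before the fronts of
   both n and n+1. *)
pose V := front n.+1 - 2.
pose v i : R := - k%:R + (n.+1 %% 4)%:R / 4 + i%:R / 2.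
have v0 : v 0%N = - k%:R + (n.+1 %% 4)%:R / 4 by rewrite /v mul0r addr0.
have vm : v (4 * k)%N = k%:R + (n.+1 %% 4)%:R / 4 by rewrite /v natrM; field.
have near_wave m x : (m == n) || (m == n.+1) ->
    v 0%N <= x <= v (4 * k)%N -> `|scaled_val m x + 2 * wave m x| <= 2^-1.
  rewrite v0 vm => mn /andP[x1 x2]; apply: (h1 m V).
  - by case/orP: mn => /eqP -> //; exact: leqW.
  - by rewrite /V; apply/andP; split; lra.
  - have m0 : (0 < m)%N by case/orP: mn => /eqP ->.
    have fm : V <= front m - 1 by rewrite /V; case/orP: mn => /eqP ->; lra.
    apply: (le_trans _ (scaled_pow_front_le m0 _)); last by rewrite /V in fm; lra.
    by apply: scaled_pow_le; rewrite fm andbT /V; lra.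
apply/andP; split.
  apply: (leq_trans (nroots_bulk_ge near_wave k0)).
  by apply: nroots_sub.
have gap : front (n.+1 - J)%N + J%:R / 26 <= front n.+1.
  by apply: front_gap; rewrite ?subn_gt0 // ltnW.
have tail (P : pred R) : convex_pred P ->
    (forall x, P x -> v (4 * k)%N <= x \/ x <= v 0%N) -> (nroots (b n.+1) P <= J)%N.
  move=> cP hP; have dE := bernoulli_derivn (ltnW lt_J).
  apply: nroots_derivn => //; rewrite dE ?bernoulli_neq0 //.
  move=> x /hP hx; rewrite root_scaled_val; apply: h2 => //.
  rewrite v0 vm in hx; rewrite -natr1 in k2.
  by case: hx => hx; [left|right]; lra.
pose L : pred R := fun x => x <= v 0%N.
pose U : pred R := fun x => v (4 * k)%N <= x.
pose M : pred R := fun x => v 0%N <= x <= v (4 * k)%N.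
have hM : (nroots (b n.+1) M <= 4 * k)%N := nroots_bulk_le near_wave k0.
have hL : (nroots (b n.+1) L <= J)%N.
  by apply: tail => [x y z _ Lz /andP[_ yz]|x Lx]; [exact: le_trans yz Lz | right].
have hU : (nroots (b n.+1) U <= J)%N.
  by apply: tail => [x y z Ux _ /andP[xy _]|x Ux]; [exact: le_trans Ux xy | left].
have : (nroots (b n.+1) xpredT <= nroots (b n.+1) (predU M (predU L U)))%N.
  apply: nroots_sub => x _ _; rewrite /= /M /L /U.
  by case: (leP (v 0%N) x) => ?; case: (leP (v (4 * k)%N) x) => ?;
    rewrite ?orbT ?andbT //=; rewrite ltW ?orbT.
move=> /leq_trans; apply; apply: leq_trans (nrootsU _ _ _) _.
apply: leq_add hM _; apply: leq_trans (nrootsU _ _ _) _.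
exact: leq_add hL hU.
Qed.

End RealRoots.

Lemma nroots_scale (R : rcfType) (c : R) (p : {poly R}) (P : pred R) : c != 0 ->
  nroots (c *: p) P = nroots p P.
Proof.
move=> c0; have [->|p0] := eqVneq p 0; first by rewrite scaler0.
have cp0 : c *: p != 0 by rewrite scaler_eq0 negb_or c0.
rewrite /nroots; have -> : rootsR (c *: p) = rootsR p.
  apply: (irr_sorted_eq lt_trans lt_irreflexive); rewrite ?rootsR_sorted // => x.
  by rewrite !mem_rootsR // rootZ.
apply: eq_bigr => x _; rewrite -mul_polyC mupMr //.
by rewrite rootE hornerC.
Qed.

Theorem theorem3 (R : realType) (B : nat -> {poly rat}) (hB : is_bernoulli B) :
  (fun n : nat => (count_real_roots R (B n))%:R : R) =
    (fun n : nat => 2 * n%:R / (pi * expR 1) + ln n%:R / (pi * expR 1))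
    +O_\oo (fun=> 1 : R).
Proof.
apply/eqaddOP.
have egf := is_bernoulli_egf R hB.
have [N [J hN]] := nroots_bernoulli egf; have [N' hN'] := @front_ge4 R.
near=> C.
exists (N + N')%N => //= n /= le_n.
have le_N : (N <= n)%N := leq_trans (leq_addr _ _) le_n.
have le_N' : (N' <= n)%N := leq_trans (leq_addl _ _) le_n.
have countE : count_real_roots R (B n) =
    nroots ((n`!)%:R^-1 *: map_poly ratr (B n) : {poly R}) xpredT.
  by rewrite nroots_scale // invr_neq0 // factr_neq0.
have f4 := hN' n le_N'.
(* Truncation leaves k > front - 4, so the lower estimate loses at most 16; the upper one adds 2
   J. *)
have C_ge : 2 * J%:R + 16 <= C by near: C; exact: nbhs_pinfty_ge.
have close_front : `|(count_real_roots R (B n))%:R - 4 * front R n| <= C.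
  have /andP[] := hN n le_N; rewrite -countE.
  have /andP[] : (Num.truncn (front R n - 3))%:R <= front R n - 3
      < (Num.truncn (front R n - 3)).+1%:R by apply: truncn_itv; lra.
  move: (Num.truncn _) (count_real_roots _ _) => k c k1 k2 c1 c2.
  have {}c1 : 4 * k%:R <= c%:R :> R by rewrite -natrM ler_nat.
  have {}c2 : c%:R <= 4 * k%:R + (J%:R + J%:R) :> R.
    by rewrite -natrM -!natrD ler_nat.
  have J0 := ler0n R J.
  rewrite -natr1 in k2.
  by rewrite ler_norml; apply/andP; split; lra.
rewrite normr1 mulr1; apply: le_trans close_front.
rewrite le_eqVlt; apply/orP; left; apply/eqP; congr `|_|.
rewrite !fctE /front; congr (_ - _).
have := lt0r_neq0 (pi_gt0 R); have := lt0r_neq0 (expR_gt0 (1 : R)).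
by move: pi (expR 1) (ln n%:R) => p e l e0 p0; field; rewrite e0 p0.
Unshelve. all: by end_near.
Qed.
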